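(* Let $S$ be a linear operator on $F^2_\alpha$ satisfying the standing assumptions. If there exist some $p>2$ and $C>0$ such that $\|S_z1\|_p\le C$ for all $z\in\mathbb{C}$, then $S$ is bounded on $F^2_\alpha$.
   Context: Fix $\alpha>0$. Let $d\lambda_\alpha(z)=\frac{\alpha}{\pi}e^{-\alpha|z|^2}\,dA(z)$, where $dA$ is Euclidean area measure on $\mathbb{C}$ (a probability measure). The Fock space $F^2_\alpha$ is the closed subspace of $L^2(\mathbb{C},d\lambda_\alpha)$ consisting of entire functions, with the inherited inner product $\langle f,g\rangle=\int_{\mathbb{C}}f\overline{g}\,d\lambda_\alpha$; its reproducing kernel is $K_w(z)=K(z,w)=e^{\alpha z\overline{w}}$. For $p>0$ write $\|f\|_p=\left(\int_{\mathbb{C}}|f|^p\,d\lambda_\alpha\right)^{1/p}\in[0,\infty]$. Let $\mathcal{D}$ be the set of all finite linear combinations of kernel functions $K_w$, $w\in\mathbb{C}$; it is dense in $F^2_\alpha$. Standing assumptions: a linear operator $S$ on $F^2_\alpha$ is not necessarily bounded or everywhere defined, but the domain of $S$ contains $\mathcal{D}$, the domain of its adjoint $S^*$ contains $\mathcal{D}$, and the map $z\mapsto SK_z$ is conjugate analytic. Saying that $S$ is bounded on $F^2_\alpha$ means that $S$ extends to a bounded linear operator on all of $F^2_\alpha$. For $z\in\mathbb{C}$ let $\varphi_z(w)=z-w$, let $k_z(w)=K(w,z)/\sqrt{K(z,z)}=e^{-\frac{\alpha}{2}|z|^2+\alpha w\overline{z}}$ be the normalized reproducing kernel, and let $U_z$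 be the operator on $F^2_\alpha$ given by $U_zf=(f\circ\varphi_z)k_z$. Each $U_z$ is a self-adjoint unitary operator and maps $\mathcal{D}$ onto $\mathcal{D}$. Set $S_z=U_zSU_z$; here $1=K_0\in\mathcal{D}$ denotes the constant function. *)

(* Defs.v *)
From HB Require Import structures.
From mathcomp Require Import all_boot all_order all_algebra.
From mathcomp Require Import complex.
From mathcomp Require Import all_classical all_reals all_analysis.
From mathcomp Require Import measurable_realfun.

Set Implicit Arguments.
Unset Strict Implicit.
Unset Printing Implicit Defensive.

Import Order.TTheory GRing.Theory Num.Theory.
Import ComplexField.Normc numFieldNormedType.Exports.

Local Open Scope classical_set_scope.
Local Open Scope complex_scope.
Local Open Scope ring_scope.

(** * The Fock space F^2_alpha

    Elements of F^2_alpha are honest functions [R[i] -> R[i]].  Measure theory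
    takes place on the plane [R * R], identified with [R[i]] through [toC]. *)

Section FockSpace.
Context {R : realType}.
Implicit Types (z w : R[i]) (f g h : R[i] -> R[i]).

Local Notation plane := (measurableTypeR R * measurableTypeR R)%type.

Definition toC (x : plane) : R[i] := (x.1 : R) +i* (x.2 : R).

Definition area : set plane -> \bar R :=
  (@lebesgue_measure R \x @lebesgue_measure R)%E.

Definition cexp z : R[i] :=
  (expR (complex.Re z))%:C * (cos (complex.Im z) +i* sin (complex.Im z)).

(** [R[i]^o] is the normed module over the field [R[i]], so that [derivable] is
    complex differentiability (and not differentiability over [R]). *)
Definition entire f :=
  forall z, derivable (f : R[i]^o -> R[i]^o) z 1.

Variable alpha : {posnum R}.

Definition gauss_density (x : plane) : R :=
  alpha%:num / pi * expR (- (alpha%:num * normc (toC x) ^+ 2)).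

Definition fock_measure (A : set plane) : \bar R :=
  (\int[area]_(x in A) (gauss_density x)%:E)%E.

Lemma gauss_density_ge0 x : (0 <= (gauss_density x)%:E)%E.
Proof. by rewrite lee_fin !mulr_ge0 ?invr_ge0 ?pi_ge0 ?expR_ge0. Qed.

Lemma measurable_gauss_density :
  measurable_fun [set: plane] (EFin \o gauss_density).
Proof.
apply/measurable_EFinP; apply: measurable_funM => //.
apply: measurableT_comp => //; apply: measurableT_comp => //.
apply: measurable_funM => //; apply: measurable_funX.
apply: measurableT_comp.
  by apply: continuous_measurable_fun => ?; exact: sqrt_continuous.
apply: (@measurable_funD _ plane _ _ (fun x => x.1 ^+ 2) (fun x => x.2 ^+ 2)).
  exact: (@measurable_funX _ plane _ _ fst _ measurable_fst).
exact: (@measurable_funX _ plane _ _ snd _ measurable_snd).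
Qed.

Lemma fock_measure0 : fock_measure set0 = 0%E.
Proof. by rewrite /fock_measure integral_set0. Qed.

Lemma fock_measure_ge0 A : (0 <= fock_measure A)%E.
Proof. by apply: integral_ge0 => x _; exact: gauss_density_ge0. Qed.

Lemma fock_measure_sigma_additive : semi_sigma_additive fock_measure.
Proof.
apply: semi_sigma_additive_nng_induced.
  exact: measurable_gauss_density.
exact: gauss_density_ge0.
Qed.

HB.instance Definition _ := isMeasure.Build _ _ _ fock_measure
  fock_measure0 fock_measure_ge0 fock_measure_sigma_additive.

Definition fock_norm (p : R) f : \bar R :=
  ('N[fock_measure]_p%:E[EFin \o (fun x => normc (f (toC x)))])%E.

Definition fock : set (R[i] -> R[i]) :=
  [set f | entire f /\ (fock_norm 2 f < +oo)%E].

Definition fock_inner f g : R[i] :=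
  (\int[fock_measure]_x complex.Re (f (toC x) * conjc (g (toC x)))) +i*
  (\int[fock_measure]_x complex.Im (f (toC x) * conjc (g (toC x)))).

(** [fock_kernel w] is the function K_w. *)
Definition fock_kernel w : R[i] -> R[i] :=
  fun z => cexp (alpha%:num%:C * z * conjc w).

Definition fock_nkernel z : R[i] -> R[i] :=
  fun w => fock_kernel z w / sqrtC (fock_kernel z z).

Definition fock_kernel_span : set (R[i] -> R[i]) :=
  [set f | exists s : seq (R[i] * R[i]),
             f = fun z => \sum_(c <- s) c.1 * fock_kernel c.2 z].

Definition fock_U z f : R[i] -> R[i] := fun w => f (z - w) * fock_nkernel z w.

(** A linear operator on F^2_alpha, defined on a linear subspace; the values of
    the underlying total function outside the domain are irrelevant. *)
Record fock_operator := FockOperator {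
  dom : set (R[i] -> R[i]);
  op_fun :> (R[i] -> R[i]) -> (R[i] -> R[i]);
  dom_fock : dom `<=` fock;
  dom0 : dom (fun=> 0);
  dom_linear : forall (a : R[i]) f g,
    dom f -> dom g -> dom (fun z => a * f z + g z);
  op_fock : forall f, dom f -> fock (op_fun f);
  op_linear : forall (a : R[i]) f g, dom f -> dom g ->
    op_fun (fun z => a * f z + g z) = fun z => a * op_fun f z + op_fun g z }.

Definition adjoint_dom (S : fock_operator) : set (R[i] -> R[i]) :=
  [set g | fock g /\
     exists2 h, fock h &
       forall f, dom S f -> fock_inner (S f) g = fock_inner f h].

(** Analyticity of a map with values in the Hilbert space F^2_alpha: complex
    differentiability in norm at every point. *)
Definition fock_analytic (F : R[i] -> (R[i] -> R[i])) :=
  forall z, exists2 G, fock G &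
    fock_norm 2 (fun w => t^-1 * (F (z + t) w - F z w) - G w)
      @[t --> (0 : R[i]^o)^'] --> (0 : \bar R)%E.

Definition fock_conj_analytic (F : R[i] -> (R[i] -> R[i])) :=
  fock_analytic (fun z => F (conjc z)).

Definition standing_assumptions (S : fock_operator) :=
  [/\ fock_kernel_span `<=` dom S,
      fock_kernel_span `<=` adjoint_dom S &
      fock_conj_analytic (fun z => S (fock_kernel z))].

Definition fock_conj (S : fock_operator) z f : R[i] -> R[i] :=
  fock_U z (S (fock_U z f)).

Definition fock_bounded (S : fock_operator) :=
  exists T : fock_operator,
    [/\ dom T = fock,
        forall f, dom S f -> T f = S f &
        exists2 M : R, 0 <= M &
          forall f, fock f -> (fock_norm 2 (T f) <= M%:E * fock_norm 2 f)%E].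

End FockSpace.

(* Main.v *)
From HB Require Import structures.
Require Import Defs.
From mathcomp Require Import all_boot all_order all_algebra.
From mathcomp Require Import complex.
From mathcomp Require Import all_classical all_reals all_analysis.
From mathcomp Require Import measurable_realfun.
From mathcomp Require Import ring lra.

(** With [H z w = (S K_w) z], the function [S_z 1] is
    [w |-> H (z - w) z * e^(-alpha |z|^2 / 2) * k_z w].  A function with finite
    [L^p] norm satisfies [|f w| <= 2 ||f||_p e^(alpha |w|^2 / p)], so the hypothesis
    gives [|H z w| <= 2 C |e^(alpha z (conj w))| e^(alpha |z - w|^2 / p)].  After
    the Gaussian weights are put back, this is a convolution kernel
    [e^(-alpha (1/2 - 1/p) |z - w|^2)], integrable because [p > 2], and Schur's
    test bounds the integral operator with kernel [H].  That operator extends [S]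
    since [S f z = <f, S^* K_z>] and [S^* K_z w = conj (H z w)].

    Both the pointwise bound and the reproducing formula come from the identity
    [int f dlambda = f 0]: the Gaussian measure is rotation invariant, and the
    mean of [f] over a circle is [f 0] by Goursat's theorem. *)

Set Implicit Arguments.
Unset Strict Implicit.
Unset Printing Implicit Defensive.

Import Order.TTheory GRing.Theory Num.Theory.
Import ComplexField.Normc numFieldNormedType.Exports.

Local Open Scope classical_set_scope.
Local Open Scope complex_scope.
Local Open Scope ring_scope.

(** * Complex differentiability *)

Section ComplexCalculus.
Context {R : realType}.
Implicit Types (z w t d : R[i]) (f g : R[i] -> R[i]).

(** [entire] asserts only that the complex derivative exists, so the circle means rest on Goursat's
    bisection argument, which needs no continuity of the derivative. A bound or a formula at an
    arbitrary point is the one at the origin for a weighted translate of the function.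

    A bounded extension must take values in [fock], so the norm estimate is not enough: the integral
    operator has to produce entire functions. This is differentiation under the integral sign, and
    it needs control of [z |-> S K_w z] uniform in [w]. The second-order Taylor remainder of an
    entire function is therefore bounded by a multiple of its Gaussian growth constant, the multiple
    being independent of the function. The growth in [w] is kept below [e^(alpha |w|^2 / 2)], which
    can be integrated against any element of the Fock space; the room for this is again
    [1 / p < 1 / 2]. Measurability in [w] comes from the adjoint, because [S K_w z] is the conjugate
    of an entire function of [w]. *)

Lemma normc_ge0 z : 0 <= normc z.
Proof. by case: z => a b; exact: sqrtr_ge0. Qed.

Lemma le_normc_Re z : `|complex.Re z| <= normc z.
Proof.
by case: z => a b /=; rewrite -sqrtr_sqr ler_wsqrtr// lerDl sqr_ge0.
Qed.

Lemma le_normc_Im z : `|complex.Im z| <= normc z.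
Proof.
by case: z => a b /=; rewrite -sqrtr_sqr ler_wsqrtr// lerDr sqr_ge0.
Qed.

Lemma normc_le_ReIm z : normc z <= `|complex.Re z| + `|complex.Im z|.
Proof.
case: z => a b /=; rewrite -[leRHS]ger0_norm ?addr_ge0// -sqrtr_sqr.
rewrite ler_wsqrtr// sqrrD !real_normK ?num_real//.
by rewrite -addrA [_ *+ 2 + _]addrC addrA lerDl mulrn_wge0// mulr_ge0.
Qed.

Lemma sqr_normc z : normc z ^+ 2 = complex.Re z ^+ 2 + complex.Im z ^+ 2.
Proof. by case: z => a b /=; rewrite sqr_sqrtr// addr_ge0// sqr_ge0. Qed.

Lemma le_normcB z w : normc z - normc w <= normc (z - w).
Proof.
by rewrite lerBlDr; apply: le_trans (le_normcD _ _); rewrite subrK.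
Qed.

Lemma normcJ z : normc (conjc z) = normc z.
Proof. by case: z => a b /=; rewrite sqrrN. Qed.

Lemma normc_real (r : R) : normc r%:C = `|r|.
Proof. by rewrite /= expr0n addr0 sqrtr_sqr. Qed.

(** The difference quotient is multiplied out, so that [t = 0] is allowed, and all quantities are
    real; later estimates use this form of differentiability. *)
Definition cderiv_at f z d := forall e : R, 0 < e ->
  exists2 r : R, 0 < r &
    forall t, normc t < r -> normc (f (z + t) - f z - d * t) <= e * normc t.

Lemma entire_cderiv f : entire f <-> forall z, exists d, cderiv_at f z d.
Proof.
have normE (x : R[i]^o) : `|x| = (normc x)%:C by case: x.
split=> [ef z|ef z].
  have /cvg_ex[l /= /cvgrPdist_le fl] := ef z.
  exists l => e e0.
  have /fl[/= e' e'0 he'] : (0 : R[i]) < e%:C by rewrite ltcR.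
  (* In the order of [R[i]], positivity forces the imaginary part to vanish, so the radius is a real
     number. *)
  have [r r0 e'E] : exists2 r, 0 < r & e' = r%:C.
    move: e'0; case: e' he' => a b _; rewrite ltcE/= => /andP[/eqP -> a0].
    by exists a.
  exists r => // t tr; have [->|t0] := eqVneq t 0.
    by rewrite addr0 subrr mulr0 subr0 !normc0 mulr0.
  have := he' t; rewrite /ball /= sub0r normrN normE e'E ltcR => /(_ tr t0).
  rewrite normE lecR => H.
  have -> : f (z + t) - f z - l * t = - (t * (l - t^-1 *: (f (t *: 1 + z) - f z))).
    rewrite mulrBr /GRing.scale/= mulrA divff// mul1r mulr1 addrC [t * l]mulrC.
    by rewrite [t + z]addrC; ring.
  by rewrite normcN normcM mulrC ler_wpM2r// normc_ge0.
have [l fl] := ef z; apply/cvg_ex; exists l; apply/cvgrPdist_le => /= e.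
case: e => e b; rewrite ltcE/= => /andP[/eqP -> e0].
have [r r0 fr] := fl e e0.
exists r%:C => /=; first by rewrite ltcR.
move=> t; rewrite /ball /= sub0r normrN normE ltcR => tr t0.
rewrite normE lecR.
have -> : l - t^-1 *: (f (t *: 1 + z) - f z) = - (t^-1 * (f (z + t) - f z - l * t)).
  rewrite [in RHS]mulrBr mulrCA mulVf// mulr1 /GRing.scale/= mulr1.
  by rewrite [t + z]addrC; ring.
rewrite normcN normcM normcV ler_pdivrMl; last first.
  by rewrite lt0r normc_ge0 andbT; apply: contra t0 => /eqP/eq0_normc ->.
by rewrite [leRHS]mulrC fr.
Qed.

Lemma entire_cst d : entire (fun=> d).
Proof. by move=> z; exact: (@derivable_cst _ R[i]^o R[i]^o d z 1). Qed.

Lemma entire_id : entire (fun z => z).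
Proof. by move=> z; exact: (@derivable_id _ R[i]^o z 1). Qed.

Lemma entireD f g : entire f -> entire g -> entire (fun z => f z + g z).
Proof. by move=> ef eg z; exact: (@derivableD _ R[i]^o R[i]^o f g z 1). Qed.

Lemma entireM f g : entire f -> entire g -> entire (fun z => f z * g z).
Proof. by move=> ef eg z; exact: (@derivableM _ R[i]^o f g z 1). Qed.

Lemma entire_comp f g : entire f -> entire g -> entire (fun z => f (g z)).
Proof.
move=> ef eg z.
apply/(@derivable1_diffP R[i] R[i]^o (fun z => f (g z)) z).
apply: (@differentiable_comp _ R[i]^o R[i]^o R[i]^o g f).
  exact/derivable1_diffP.
exact/derivable1_diffP.
Qed.

Lemma cexp0 : cexp 0 = 1 :> R[i].
Proof.
by rewrite /cexp /= expR0 cos0 sin0 rmorph1 mul1r.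
Qed.

Lemma cexpD z w : cexp (z + w) = cexp z * cexp w.
Proof.
rewrite /cexp; case: z => a b; case: w => c d /=.
rewrite expRD cosD sinD; apply/eqP; rewrite eq_complex /=.
by apply/andP; split; apply/eqP; ring.
Qed.

Lemma normc_cexp z : normc (cexp z) = expR (complex.Re z).
Proof.
rewrite /cexp normcM normc_real ger0_norm ?expR_ge0//= cos2Dsin2 sqrtr1.
by rewrite mulr1.
Qed.

Lemma cexp_real (r : R) : cexp r%:C = (expR r)%:C.
Proof. by rewrite /cexp /= cos0 sin0 mulr1. Qed.

Lemma conjc_cexp z : conjc (cexp z) = cexp (conjc z).
Proof.
case: z => a b; rewrite /cexp /=; apply/eqP; rewrite eq_complex /= cosN sinN.
by apply/andP; split; apply/eqP; ring.
Qed.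

Let abs_sub_le (f df : R -> R) (M x : R) :
  (forall y : R, is_derive y (1 : R) f (df y)) ->
  (forall y, `|y| <= `|x| -> `|df y| <= M) -> `|f x - f 0| <= M * `|x|.
Proof.
move=> fdf dfM.
have cf (a b : R) : {within `[a, b], continuous f}.
  apply: derivable_within_continuous => y _.
  exact: (@ex_derive _ _ _ _ _ _ _ (fdf y)).
have [x0|x0] := leP 0 x.
  have [c cx ->] := MVT_segment x0 (fun y _ => fdf y) (cf _ _).
  rewrite subr0 normrM ler_wpM2r// dfM//.
  by move: cx; rewrite in_itv/= => /andP[c0 cx]; rewrite !ger0_norm.
have [c cx E] := MVT_segment (ltW x0) (fun y _ => fdf y) (cf _ _).
rewrite distrC E sub0r normrM normrN ler_wpM2r// dfM//.
move: cx; rewrite in_itv/= => /andP[xc c0].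
by rewrite ler0_norm// ltr0_norm// lerN2.
Qed.

Let cosB1_le (x : R) : `|cos x - 1| <= `|x|.
Proof.
rewrite -(@cos0 R) -[leRHS]mul1r; apply: (@abs_sub_le _ (fun y => - sin y)).
by move=> y _; rewrite normrN sin_max.
Qed.

Let sin_le (x : R) : `|sin x| <= `|x|.
Proof.
rewrite -[sin x]subr0 -(@sin0 R) -[leRHS]mul1r.
apply: (@abs_sub_le _ cos) => y _; exact: cos_max.
Qed.

Let cosB1_le_sqr (x : R) : `|cos x - 1| <= x ^+ 2.
Proof.
rewrite -(@cos0 R) -real_normK ?num_real// expr2.
apply: (@abs_sub_le _ (fun y => - sin y)) => y yx.
by rewrite normrN (le_trans (sin_le _)).
Qed.

Let sinB_le_sqr (x : R) : `|sin x - x| <= x ^+ 2.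
Proof.
rewrite -real_normK ?num_real// expr2.
have -> : sin x - x = (sin x - x) - (sin 0 - 0) by rewrite sin0 subrr subr0.
apply: (@abs_sub_le (fun y => sin y - y) (fun y => cos y - 1)) => y yx.
by rewrite (le_trans (cosB1_le _)).
Qed.

(** Multiply [1 - x <= expR (- x)] by [expR x]. *)
Let expRB1_le_mul (x : R) : expR x - 1 <= x * expR x.
Proof.
suff : (1 - x) * expR x <= 1 by lra.
by rewrite -[leRHS](expRxMexpNx_1 x) [leRHS]mulrC ler_pM2r ?expR_gt0// expR_ge1Dx.
Qed.

Let expR_norm_ge1 (x : R) : 1 <= expR `|x|.
Proof. by rewrite -expR0 ler_expR. Qed.

Let expRB1_le (x : R) : `|expR x - 1| <= `|x| * expR `|x|.
Proof.
have H := expR_ge1Dx x; have [x0|x0] := leP 0 x.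
  by rewrite !ger0_norm//; lra.
have : expR x <= 1 by rewrite -expR0 ler_expR ltW.
rewrite -subr_le0 => /ler0_norm ->.
apply: (@le_trans _ _ `|x|); first by rewrite ltr0_norm//; lra.
by rewrite ler_peMr// expR_norm_ge1.
Qed.

Let expRB1B_le (x : R) : `|expR x - 1 - x| <= x ^+ 2 * expR `|x|.
Proof.
have H := expR_ge1Dx x; have h := expRB1_le_mul x.
rewrite ger0_norm; last by lra.
have h2 : expR x - 1 - x <= x * (expR x - 1) by lra.
apply: (le_trans h2); have [x0|x0] := leP 0 x.
  by rewrite ger0_norm// expr2 -mulrA ler_wpM2l.
apply: (@le_trans _ _ (x ^+ 2)); last by rewrite ler_peMr ?sqr_ge0.
by rewrite expr2 ler_nM2l//; lra.
Qed.

(** The bound is global, not only near 0, because it is later applied under a Gaussian integral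
    where the argument is unbounded. The 4 counts the terms: the real and the imaginary part each
    split into two, and each term is at most [|z|^2 e^|z|]. *)
Lemma cexp_taylor z : normc (cexp z - 1 - z) <= 4 * normc z ^+ 2 * expR (normc z).
Proof.
apply: (le_trans (normc_le_ReIm _)).
case: z => a b.
have := le_normc_Re (a +i* b); have := le_normc_Im (a +i* b).
have := normc_ge0 (a +i* b); move: (normc (a +i* b)) => N /= N0 bN aN.
have -> : expR a * cos b - 0 * sin b - 1 - a =
   expR a * (cos b - 1) + (expR a - 1 - a) by ring.
have -> : expR a * sin b + 0 * cos b - 0 - b =
   expR a * (sin b - b) + (expR a - 1) * b by ring.
have eaN : expR a <= expR N.
  by rewrite ler_expR (le_trans (ler_norm _)).
have eaN' : expR `|a| <= expR N by rewrite ler_expR.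
have e0 := expR_ge0 a; have e0' := expR_ge0 `|a|.
have a2 : a ^+ 2 <= N ^+ 2 by rewrite -real_normK ?num_real// lerXn2r// nnegrE.
have b2 : b ^+ 2 <= N ^+ 2 by rewrite -real_normK ?num_real// lerXn2r// nnegrE.
have ab : `|a| * `|b| <= N ^+ 2 by rewrite expr2 ler_pM.
have -> : 4 * N ^+ 2 * expR N = (expR N * N ^+ 2 + N ^+ 2 * expR N) +
   (expR N * N ^+ 2 + N ^+ 2 * expR N) by ring.
apply: lerD; apply: (le_trans (ler_normD _ _)); rewrite normrM ger0_norm//;
  apply: lerD.
- by apply: ler_pM => //; exact: le_trans (cosB1_le_sqr b) b2.
- by apply: le_trans (expRB1B_le _) _; apply: ler_pM => //; exact: sqr_ge0.
- by apply: ler_pM => //; exact: le_trans (sinB_le_sqr b) b2.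
- rewrite normrM (le_trans (ler_wpM2r _ (expRB1_le _)))// mulrAC.
  by apply: ler_pM => //; exact: mulr_ge0.
Qed.

Lemma entire_cexp : entire (@cexp R).
Proof.
apply/entire_cderiv => z; exists (cexp z) => e e0.
set c := 4 * expR 1 * normc (cexp z).
have c0 : 0 <= c by rewrite !mulr_ge0 ?expR_ge0 ?normc_ge0.
exists (Num.min 1 (e / (c + 1))).
  by rewrite lt_min ltr01 divr_gt0// ltr_pwDr.
move=> t; rewrite lt_min => /andP[t1 te].
have -> : cexp (z + t) - cexp z - cexp z * t = cexp z * (cexp t - 1 - t).
  by rewrite cexpD; ring.
rewrite normcM.
apply: (le_trans (ler_wpM2l (normc_ge0 _) (cexp_taylor _))).
have t0 := normc_ge0 t.
apply: (@le_trans _ _ (c * normc t * normc t)).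
  rewrite /c expr2.
  have : expR (normc t) <= expR 1 by rewrite ler_expR ltW.
  have := normc_ge0 (cexp z); have := expR_ge0 (normc t).
  set u := expR _; set v := normc (cexp z); set n := normc t => u0 v0 u1.
  have -> : v * (4 * (n * n) * u) = 4 * (v * (n * n)) * u by ring.
  have -> : 4 * expR 1 * v * n * n = 4 * (v * (n * n)) * expR 1 by ring.
  by rewrite ler_wpM2l// !mulr_ge0.
rewrite ler_wpM2r//; move: te; rewrite ltr_pdivlMr ?ltr_pwDr// => te.
by apply/ltW/(le_lt_trans _ te); rewrite mulrC ler_wpM2l// lerDl.
Qed.

End ComplexCalculus.

(** * Goursat's theorem and circle means *)

Section IntervalIntegral.
Context {R : realType}.
Local Notation mu := (@lebesgue_measure R).
Implicit Types (f g : R -> R) (a b c : R).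

Lemma continuous_integrable_itv f a b :
  continuous f -> mu.-integrable `[a, b] (EFin \o f).
Proof.
move=> cf; apply: continuous_compact_integrable; first exact: segment_compact.
exact: continuous_subspaceT.
Qed.

Lemma Rintegral_itv_split f a b c : continuous f -> a <= b -> b <= c ->
  \int[mu]_(x in `[a, c]) f x =
  \int[mu]_(x in `[a, b]) f x + \int[mu]_(x in `[b, c]) f x.
Proof.
move=> cf ab bc.
have := @Rintegral_itvB _ f (BLeft a) (BRight c) b (continuous_integrable_itv a c cf).
rewrite !bnd_simp => /(_ ab bc).
rewrite Rintegral_itv_obnd_cbnd; first by lra.
apply: integrableS (continuous_integrable_itv b c cf) => //.
by apply: subset_itvr; rewrite bnd_simp.
Qed.

Lemma Rintegral_itv_near f a b (k e : R) : continuous f -> a <= b ->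
  (forall x, a <= x <= b -> `|f x - k| <= e) ->
  `|\int[mu]_(x in `[a, b]) f x - k * (b - a)| <= e * (b - a).
Proof.
move=> cf ab fke.
have cstE (r : R) : \int[mu]_(x in `[a, b]) r = r * (b - a).
  rewrite Rintegral_cst//= lebesgue_measure_itv/= lte_fin.
  by case: ltP => //= ba; rewrite (_ : b = a) ?subrr//; apply/le_anti/andP.
have ik (r : R) : mu.-integrable `[a, b] (EFin \o cst r).
  by apply: continuous_integrable_itv => ?; exact: cvg_cst.
have iff := continuous_integrable_itv a b cf.
rewrite -cstE -RintegralB//; last exact: (ik k).
have ifk : mu.-integrable `[a, b] (EFin \o (fun x => f x - k)).
  by apply: continuous_integrable_itv => x; apply: cvgB; [exact: cf|exact: cvg_cst].
apply: (le_trans (le_normr_Rintegral _ ifk)) => //.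
rewrite -cstE; apply: le_Rintegral => //.
  exact: integrable_norm.
exact: ik.
Qed.

End IntervalIntegral.

(** * Goursat's theorem for closed forms on rectangles *)

Section Goursat.
Context {R : realType}.
Local Notation mu := (@lebesgue_measure R).
Variables A B : R -> R -> R.

(** The form is [A dx + B dy]. The shared coefficient [c] says that the partial derivative of [A] in
    [y] equals that of [B] in [x]; nothing is asked about how the coefficients vary with the
    point. *)
Definition closed_form_at (x0 y0 : R) := exists a b c : R,
  forall e : R, 0 < e -> exists2 r : R, 0 < r & forall x y,
    `|x - x0| < r -> `|y - y0| < r ->
    `|A x y - A x0 y0 - (a * (x - x0) + c * (y - y0))|
      <= e * (`|x - x0| + `|y - y0|) /\
    `|B x y - B x0 y0 - (c * (x - x0) + b * (y - y0))|
      <= e * (`|x - x0| + `|y - y0|).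

Hypothesis AB : forall x y, closed_form_at x y.
Hypothesis cA : forall y, continuous (A ^~ y).
Hypothesis cB : forall x, continuous (B x).

(** The integral of [A dx + B dy] counterclockwise along the boundary of a rectangle. *)
Definition boundary_integral (x x' y y' : R) : R :=
  \int[mu]_(t in `[x, x']) A t y + \int[mu]_(s in `[y, y']) B x' s -
  \int[mu]_(t in `[x, x']) A t y' - \int[mu]_(s in `[y, y']) B x s.

Local Notation J := boundary_integral.

Let J_splitx x m x' y y' : x <= m -> m <= x' ->
  J x x' y y' = J x m y y' + J m x' y y'.
Proof.
move=> xm mx'; rewrite /boundary_integral.
rewrite (Rintegral_itv_split (@cA y) xm mx').
rewrite (Rintegral_itv_split (@cA y') xm mx'); lra.
Qed.

Let J_splity x x' y m y' : y <= m -> m <= y' ->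
  J x x' y y' = J x x' y m + J x x' m y'.
Proof.
move=> ym my'; rewrite /boundary_integral.
rewrite (Rintegral_itv_split (@cB x) ym my').
rewrite (Rintegral_itv_split (@cB x') ym my'); lra.
Qed.

(** To first order, the horizontal sides contribute [- c m l] and the vertical ones [c l m], which
    cancel. What remains is an error of [2 e (l + m)] integrated over lengths [l] and [m]. *)
Let J_small x0 y0 e : 0 < e -> exists2 r : R, 0 < r & forall x y l m : R,
  0 <= l < r -> 0 <= m < r -> x <= x0 <= x + l -> y <= y0 <= y + m ->
  `|J x (x + l) y (y + m)| <= 2 * e * (l + m) ^+ 2.
Proof.
move=> e0; have [a [b [c /(_ _ e0)[r r0 H]]]] := AB x0 y0.
exists r => // x y l m /andP[l0 lr] /andP[m0 mr] /andP[xx0 x0x] /andP[yy0 y0y].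
have inx t : x <= t <= x + l -> `|t - x0| <= l.
  by move=> /andP[? ?]; rewrite ler_norml; lra.
have iny t : y <= t <= y + m -> `|t - y0| <= m.
  by move=> /andP[? ?]; rewrite ler_norml; lra.
have xl : x <= x + l by lra.
have ym : y <= y + m by lra.
have yy : y <= y <= y + m by lra.
have ym' : y <= y + m <= y + m by lra.
have xx : x <= x <= x + l by lra.
have xl' : x <= x + l <= x + l by lra.
have cAd : continuous (fun t => A t y - A t (y + m)).
  by move=> t; apply: cvgB; exact: cA.
have cBd : continuous (fun s => B (x + l) s - B x s).
  by move=> t; apply: cvgB; exact: cB.
have HA t : x <= t <= x + l ->
    `|A t y - A t (y + m) - (- (c * m))| <= 2 * e * (l + m).
  move=> /inx tl; have ltr := le_lt_trans tl lr.
  have [+ _] := H t y ltr (le_lt_trans (iny _ yy) mr).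
  have [+ _] := H t (y + m) ltr (le_lt_trans (iny _ ym') mr).
  have := iny _ yy; have := iny _ ym'.
  rewrite (_ : A t y - A t (y + m) - - (c * m) =
    (A t y - A x0 y0 - (a * (t - x0) + c * (y - y0))) -
    (A t (y + m) - A x0 y0 - (a * (t - x0) + c * (y + m - y0)))); last by ring.
  set u := (X in `|X - _|); set v := (X in `|_ - X|) => h1 h2 h3 h4.
  apply: (le_trans (ler_normB _ _)).
  have -> : 2 * e * (l + m) = e * (l + m) + e * (l + m) by ring.
  apply: lerD.
    by apply: (le_trans h4); rewrite ler_pM2l// lerD.
  by apply: (le_trans h3); rewrite ler_pM2l// lerD.
have HB s : y <= s <= y + m ->
    `|B (x + l) s - B x s - c * l| <= 2 * e * (l + m).
  move=> /iny sm; have ltr := le_lt_trans sm mr.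
  have [_ +] := H x s (le_lt_trans (inx _ xx) lr) ltr.
  have [_ +] := H (x + l) s (le_lt_trans (inx _ xl') lr) ltr.
  have := inx _ xx; have := inx _ xl'.
  rewrite (_ : B (x + l) s - B x s - c * l =
    (B (x + l) s - B x0 y0 - (c * (x + l - x0) + b * (s - y0))) -
    (B x s - B x0 y0 - (c * (x - x0) + b * (s - y0)))); last by ring.
  set u := (X in `|X - _|); set v := (X in `|_ - X|) => h1 h2 h3 h4.
  apply: (le_trans (ler_normB _ _)).
  have -> : 2 * e * (l + m) = e * (l + m) + e * (l + m) by ring.
  apply: lerD.
    by apply: (le_trans h3); rewrite ler_pM2l// lerD.
  by apply: (le_trans h4); rewrite ler_pM2l// lerD.
have KA := Rintegral_itv_near cAd xl HA.
have KB := Rintegral_itv_near cBd ym HB.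
move: KA KB; rewrite RintegralB//; try exact: continuous_integrable_itv.
rewrite RintegralB//; try exact: continuous_integrable_itv.
rewrite /boundary_integral; set I1 := Rintegral _ _ _; set I2 := Rintegral _ _ _.
set I3 := Rintegral _ _ _; set I4 := Rintegral _ _ _ => KA KB.
rewrite (_ : I1 + I3 - I2 - I4 =
  (I1 - I2 - (- (c * m)) * (x + l - x)) + (I3 - I4 - c * l * (y + m - y)));
  last by ring.
apply: (le_trans (ler_normD _ _)).
apply: (le_trans (lerD KA KB)).
by rewrite le_eqVlt; apply/orP; left; apply/eqP; ring.
Qed.

Section Bisection.
Variables (x0 y0 L M : R).
Hypotheses (L0 : 0 <= L) (M0 : 0 <= M).

Let side (S : R) n := S * 2^-1 ^+ n.

Let sideS S n : side S n = side S n.+1 + side S n.+1.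
Proof. by rewrite /side exprS; field. Qed.

Let side_ge0 S n : 0 <= S -> 0 <= side S n.
Proof. by move=> S0; rewrite mulr_ge0// exprn_ge0. Qed.

Let large (E : R) n (p : R * R) :=
  E * 4^-1 ^+ n <=
  `|J p.1 (p.1 + side L n) p.2 (p.2 + side M n)|.

(** Stated as an implication so that a successor exists for every [p] and [step] is a total
    function; the premise is carried along the iteration. *)
Let step_spec E n (p q : R * R) := large E n p ->
  [/\ large E n.+1 q,
     p.1 <= q.1, q.1 + side L n.+1 <= p.1 + side L n,
     p.2 <= q.2 & q.2 + side M n.+1 <= p.2 + side M n].

Let step_ex E n p : exists q, step_spec E n p q.
Proof.
rewrite /step_spec; case: p => x y.
(* If the rectangle is not large, the premise of [step_spec] fails and [(0, 0)] is a dummy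
   corner. *)
have [H|] := asboolP (large E n (x, y)); last by move=> nH; exists (0, 0) => /nH.
have l0 := @side_ge0 L n.+1 L0; have m0 := @side_ge0 M n.+1 M0.
have [q [Hq h]] : exists q, large E n.+1 q /\
    ((q.1 = x) \/ (q.1 = x + side L n.+1)) /\
    ((q.2 = y) \/ (q.2 = y + side M n.+1)).
  (* If all four quarters fell below [E / 4^(n+1)], their sum would fall below [E / 4^n]; inner
     edges cancel, so this sum is the integral over the whole boundary. *)
  apply: contrapT => nq.
  have small x' y' : (x' = x) \/ (x' = x + side L n.+1) ->
      (y' = y) \/ (y' = y + side M n.+1) ->
      `|J x' (x' + side L n.+1) y' (y' + side M n.+1)| < E * 4^-1 ^+ n.+1.
    move=> hx hy; rewrite ltNge; apply/negP => hE.
    by apply: nq; exists (x', y').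
  move: H; rewrite /large /= (@J_splitx x (x + side L n.+1)); last 2 first.
  - by rewrite lerDl.
  - by rewrite lerD2l (sideS L n) lerDl.
  rewrite (@J_splity x _ y (y + side M n.+1)); last 2 first.
  - by rewrite lerDl.
  - by rewrite lerD2l (sideS M n) lerDl.
  rewrite (@J_splity (x + side L n.+1) _ y (y + side M n.+1)); last 2 first.
  - by rewrite lerDl.
  - by rewrite lerD2l (sideS M n) lerDl.
  rewrite (sideS L n) (sideS M n) (addrA x) (addrA y) addrA.
  have := small _ _ (or_introl erefl) (or_introl erefl).
  have := small _ _ (or_introl erefl) (or_intror erefl).
  have := small _ _ (or_intror erefl) (or_introl erefl).
  have := small _ _ (or_intror erefl) (or_intror erefl).
  move: (J _ _ _ _) (J _ _ _ _) (J _ _ _ _) (J _ _ _ _) => a b c d ha hb hc hd.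
  have -> : E * 4^-1 ^+ n = E * 4^-1 ^+ n.+1 + E * 4^-1 ^+ n.+1 +
     E * 4^-1 ^+ n.+1 + E * 4^-1 ^+ n.+1 by rewrite exprS; field.
  apply/negP; rewrite -ltNge.
  have tri (s t u v : R) : `|s + t + u + v| <= `|s| + `|t| + `|u| + `|v|.
    have := ler_normD s t; have := ler_normD (s + t) u.
    by have := ler_normD (s + t + u) v; lra.
  by apply: (le_lt_trans (tri _ _ _ _)); lra.
exists q => _; have := sideS L n; have := sideS M n.
case: q Hq h => q1 q2 Hq /= [h1 h2] hM hL.
by split => //=; [case: h1|case: h1|case: h2|case: h2] => ->; lra.
Qed.

Let step E n p := sval (cid (step_ex E n p)).

Fixpoint corner (E : R) n := if n is n'.+1 then step E n' (corner E n') else (x0, y0).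

(** Otherwise quadrisection gives nested rectangles whose boundary integral is at
    least [E / 4^n], against the local bound [J_small] at their common point. *)
Lemma goursat : J x0 (x0 + L) y0 (y0 + M) = 0.
Proof.
apply/eqP; apply: contrapT => /negP J0.
set E := `|J x0 (x0 + L) y0 (y0 + M)|.
have E0 : 0 < E by rewrite normr_gt0.
pose p := corner E.
have lp n : large E n (p n).
  elim: n => [|n ih]; first by rewrite /large /side !expr0 !mulr1.
  by have [] := svalP (cid (step_ex E n (p n))) ih.
have pS n := svalP (cid (step_ex E n (p n))) (lp n).
(* Nested intervals: every left end lies below every right end, so the limit of the left ends is a
   common point. *)
have nest (u : nat -> R) S : 0 <= S -> (forall n, u n <= u n.+1) ->
    (forall n, u n.+1 + side S n.+1 <= u n + side S n) ->
    exists X, forall n, u n <= X <= u n + side S n.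
  move=> S0 uS uS'.
  have nd : nondecreasing_seq u by apply/nondecreasing_seqP.
  have ni : nonincreasing_seq (fun n => u n + side S n).
    by apply/nonincreasing_seqP.
  have cross m n : u m <= u n + side S n.
    apply: (@le_trans _ _ (u (maxn m n))); first exact/nd/leq_maxl.
    apply: (@le_trans _ _ (u (maxn m n) + side S (maxn m n))).
      by rewrite lerDl side_ge0.
    exact/ni/leq_maxr.
  have cu : cvgn u.
    apply: nondecreasing_is_cvgn => //; exists (u 0%N + side S 0%N).
    by move=> _ [n _ <-].
  exists (limn u) => n; apply/andP; split.
    exact: nondecreasing_cvgn_le.
  by apply: limr_le => //; apply: nearW => m.
have [X hX] : exists X, forall n, (p n).1 <= X <= (p n).1 + side L n.
  by apply: (nest (fun n => (p n).1) L L0) => n; have [] := pS n.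
have [Y hY] : exists Y, forall n, (p n).2 <= Y <= (p n).2 + side M n.
  by apply: (nest (fun n => (p n).2) M M0) => n; have [] := pS n.
(* Chosen so that [2 e (L + M)^2] is at most [E / 2]; the [+ 1] keeps the denominator positive when
   both sides have length 0. *)
pose e := E / (4 * (L + M + 1) ^+ 2).
have LM : 0 < L + M + 1 by rewrite ltr_wpDl// addr_ge0.
have e0 : 0 < e by rewrite divr_gt0// mulr_gt0// exprn_gt0.
have [r r0 Hr] := J_small X Y e0.
have [n Hn] : exists n, side (L + M) n < r.
  have /cvgrPdist_lt/(_ r r0)[n _ /(_ n (leqnn n))] :
      (fun n => side (L + M) n) @ \oo --> (0 : R).
    rewrite -[0](mulr0 (L + M)); apply: cvgM; first exact: cvg_cst.
    by apply: cvg_expr; rewrite ger0_norm//; lra.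
  rewrite sub0r normrN ger0_norm ?side_ge0 ?addr_ge0// => ?.
  by exists n.
have sD : side (L + M) n = side L n + side M n by rewrite /side mulrDl.
have l0 := @side_ge0 L n L0; have m0 := @side_ge0 M n M0.
have := Hr (p n).1 (p n).2 (side L n) (side M n).
rewrite l0 m0 /= => /(_ _ _ (hX n) (hY n)).
have -> : side L n < r by lra.
have -> : side M n < r by lra.
move=> /(_ isT isT); apply/negP; rewrite -ltNge.
apply: lt_le_trans (lp n); rewrite -sD /side.
(* The local bound scales by [1 / 4] per bisection, exactly like the lower bound, so [n] drops out
   of the comparison. *)
have -> : ((L + M) * 2^-1 ^+ n) ^+ 2 = (L + M) ^+ 2 * 4^-1 ^+ n.
  rewrite exprMn -exprM mulnC exprM; congr (_ * _ ^+ n).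
  by rewrite exprVn; congr (_^-1); ring.
rewrite mulrA ltr_pM2r ?exprn_gt0// ?invr_gt0//.
have sq : (L + M) ^+ 2 <= (L + M + 1) ^+ 2.
  by rewrite lerXn2r// ?nnegrE ?addr_ge0// lerDl.
apply: (@le_lt_trans _ _ (2 * e * (L + M + 1) ^+ 2)).
  by rewrite ler_wpM2l// mulr_ge0// ltW.
have -> : 2 * e * (L + M + 1) ^+ 2 = E / 2.
  by rewrite /e; field; rewrite gt_eqF.
lra.
Qed.

End Bisection.

End Goursat.

(** * Means of an entire function over circles *)

Section CircleMean.
Context {R : realType}.
Local Notation mu := (@lebesgue_measure R).
Implicit Types (f : R[i] -> R[i]).

Lemma cderiv_at_continuous f z d : cderiv_at f z d -> forall e : R, 0 < e ->
  exists2 r : R, 0 < r & forall t, normc t < r -> normc (f (z + t) - f z) <= e.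
Proof.
move=> fd e e0; have [r r0 H] := fd 1 ltr01.
exists (Num.min r (e / (1 + normc d))).
  by rewrite lt_min r0 divr_gt0// ltr_pwDl// normc_ge0.
move=> t; rewrite lt_min => /andP[/H h].
rewrite ltr_pdivlMr ?ltr_pwDl ?normc_ge0// => te.
have := le_normcB (f (z + t) - f z) (d * t); rewrite normcM; lra.
Qed.

Lemma entire_continuous f z (e : R) : entire f -> 0 < e ->
  exists2 r : R, 0 < r & forall t, normc t < r -> normc (f (z + t) - f z) <= e.
Proof.
by move=> /entire_cderiv/(_ z)[d] /cderiv_at_continuous; apply.
Qed.

Lemma ReB (z w : R[i]) : complex.Re (z - w) = complex.Re z - complex.Re w.
Proof. by case: z => a b; case: w. Qed.

Lemma ImB (z w : R[i]) : complex.Im (z - w) = complex.Im z - complex.Im w.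
Proof. by case: z => a b; case: w. Qed.

Lemma ReM (z w : R[i]) : complex.Re (z * w) =
  complex.Re z * complex.Re w - complex.Im z * complex.Im w.
Proof. by case: z => a b; case: w. Qed.

Lemma ImM (z w : R[i]) : complex.Im (z * w) =
  complex.Re z * complex.Im w + complex.Im z * complex.Re w.
Proof. by case: z => a b; case: w. Qed.

Lemma continuous_epsP (u : R -> R) :
  (forall x (e : R), 0 < e -> exists2 r : R, 0 < r & forall t, `|t| < r ->
    `|u (x + t) - u x| <= e) -> continuous u.
Proof.
move=> H x; apply/cvgrPdist_le => /= e e0; have [r r0 Hr] := H x e e0.
exists r => //= y; rewrite /ball /= distrC => /Hr.
by rewrite [x + _]addrC subrK distrC.
Qed.

Lemma entire_continuous_Rex f y : entire f ->
  continuous (fun x => complex.Re (f (x +i* y))).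
Proof.
move=> ef; apply: continuous_epsP => x e e0.
have [r r0 H] := entire_continuous (x +i* y) ef e0; exists r => // t tr.
have := H t%:C; rewrite normc_real => /(_ tr) h.
apply: le_trans h; rewrite -ReB; apply: le_trans (le_normc_Re _).
by rewrite /GRing.add /= addr0.
Qed.

Lemma entire_continuous_Rey f x : entire f ->
  continuous (fun y => complex.Re (f (x +i* y))).
Proof.
move=> ef; apply: continuous_epsP => y e e0.
have [r r0 H] := entire_continuous (x +i* y) ef e0; exists r => // t tr.
have := H (0 +i* t); rewrite /= expr0n/= add0r sqrtr_sqr => /(_ tr) h.
apply: le_trans h; rewrite -ReB; apply: le_trans (le_normc_Re _).
by rewrite /GRing.add /= addr0.
Qed.

(** [Im f] is the real part of the entire function [- i f]. *)
Lemma entire_continuous_Imx f y : entire f ->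
  continuous (fun x => complex.Im (f (x +i* y))).
Proof.
move=> ef; have := @entire_continuous_Rex _ y (entireM (@entire_cst R (- 'i)) ef).
rewrite (_ : (fun x => _) = fun x => complex.Im (f (x +i* y)))//.
by apply/funext => x; case: (f _) => a b /=; ring.
Qed.

Lemma entire_continuous_Imy f x : entire f ->
  continuous (fun y => complex.Im (f (x +i* y))).
Proof.
move=> ef; have := @entire_continuous_Rey _ x (entireM (@entire_cst R (- 'i)) ef).
rewrite (_ : (fun x => _) = fun y => complex.Im (f (x +i* y)))//.
by apply/funext => y; case: (f _) => a b /=; ring.
Qed.

(** [Im (f dz)] is a closed form by the Cauchy-Riemann equations. *)
Lemma entire_closed_form f x0 y0 : entire f ->
  closed_form_at (fun x y => complex.Im (f (x +i* y)))
                 (fun x y => complex.Re (f (x +i* y))) x0 y0.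
Proof.
move=> /entire_cderiv/(_ (x0 +i* y0))[[p q] fd].
(* For [f' = p + i q], the differential of [Im f] is [q dx + p dy] and that of [Re f] is
   [p dx - q dy]. *)
exists q, (- q), p => e e0.
have [r r0 H] := fd e e0; exists (r / 2); first by rewrite divr_gt0.
move=> x y xr yr.
have tN : normc ((x - x0) +i* (y - y0)) <= `|x - x0| + `|y - y0|.
  exact: normc_le_ReIm.
have := H ((x - x0) +i* (y - y0)).
have -> : (x0 +i* y0) + ((x - x0) +i* (y - y0)) = x +i* y :> R[i].
  by apply/eqP; rewrite eq_complex /= ![_ + (_ - _)]addrC !subrK !eqxx.
have tr : normc ((x - x0) +i* (y - y0)) < r.
  by apply: (le_lt_trans tN); lra.
move=> /(_ tr) h; have {}h := le_trans h (ler_wpM2l (ltW e0) tN).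
split; apply: le_trans h.
  apply: le_trans (le_normc_Im _).
  rewrite !ImB [in leRHS](_ : complex.Im (_ * _) = q * (x - x0) + p * (y - y0))//.
  by rewrite ImM/= addrC.
apply: le_trans (le_normc_Re _).
rewrite !ReB [in leRHS](_ : complex.Re (_ * _) = p * (x - x0) + - q * (y - y0))//.
by rewrite ReM/= mulNr.
Qed.

(** [f (w * cexp zeta)] has period [2 i pi], so its means over vertical segments
    of that length do not depend on the abscissa [u]; let [u] tend to [-oo]. *)
Lemma circle_mean f w : entire f ->
  \int[mu]_(x in `[0, pi *+ 2]) complex.Re (f (w * cexp (0 +i* x))) =
  complex.Re (f 0) * (pi *+ 2).
Proof.
move=> ef; pose F z := f (w * cexp z).
have eF : entire F.
  exact: (entire_comp ef (entireM (@entire_cst R w) (@entire_cexp R))).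
have pi2 : 0 <= pi *+ 2 :> R by rewrite mulrn_wge0// pi_ge0.
(* The two horizontal sides of the rectangle carry the same integrand, so they cancel in [goursat]
   and only the vertical sides remain. *)
have periodic x : F (x +i* (pi *+ 2)) = F (x +i* 0).
  by rewrite /F /cexp /= cos2pi sin2pi cos0 sin0.
have shift (u : R) : 0 <= u ->
    \int[mu]_(x in `[0, pi *+ 2]) complex.Re (F (0 +i* x)) =
    \int[mu]_(x in `[0, pi *+ 2]) complex.Re (F ((- u) +i* x)).
  move=> u0; have := @goursat R _ _ (fun x y => entire_closed_form x y eF)
    (fun y => @entire_continuous_Imx _ y eF) (fun x => @entire_continuous_Rey _ x eF)
    (- u) 0 u (pi *+ 2) u0 pi2.
  rewrite /boundary_integral addNr add0r.
  under [X in _ - X - _]eq_Rintegral do rewrite periodic.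
  lra.
apply/eqP; rewrite -subr_eq0 -normr_le0; apply/ler_addgt0Pl => e e0.
rewrite addr0; pose e' := e / (pi *+ 2).
have pi0 : 0 < pi *+ 2 :> R by rewrite mulrn_wgt0// pi_gt0.
have e'0 : 0 < e' by rewrite divr_gt0.
have [r r0 H] := entire_continuous 0 ef e'0.
(* Then [r e^u >= r (1 + u) = r + |w|], so the circle of radius [|w| e^(-u)] lies in the disc where
   [f] is within [e'] of [f 0]. *)
pose u := normc w / r.
have u0 : 0 <= u by rewrite divr_ge0 ?normc_ge0// ltW.
rewrite (shift u u0).
have := @Rintegral_itv_near R (fun x => complex.Re (F ((- u) +i* x))) 0 (pi *+ 2)
  (complex.Re (f 0)) e' (@entire_continuous_Rey _ _ eF) pi2.
rewrite subr0 /e' divfK ?gt_eqF//; apply => x _.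
rewrite -ReB; apply: (le_trans (le_normc_Re _)).
have := H (w * cexp ((- u) +i* x)); rewrite add0r; apply.
rewrite normcM normc_cexp /= expRN ltr_pdivrMr ?expR_gt0//.
have := expR_ge1Dx u; rewrite -(ler_pM2l r0) mulrDr /u.
by rewrite [r * (_ / _)]mulrC divfK ?gt_eqF//; lra.
Qed.

End CircleMean.

(** * Area and Gaussian measures *)

Section MeasurableCaratheodory.
Context d (X : measurableType d) {R : realType}.
Local Notation RM := (measurableTypeR R).

Let quant (n : nat) (y : R) : R := (Num.floor (y * n.+1%:R))%:~R / n.+1%:R.

Let quant_near n y : `|y - quant n y| <= n.+1%:R^-1.
Proof.
have n0 : 0 < n.+1%:R :> R by [].
have /andP[h1 h2] := floor_itv (y * n.+1%:R).
have -> : y - quant n y = (y * n.+1%:R - (Num.floor (y * n.+1%:R))%:~R) / n.+1%:R.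
  by rewrite /quant mulrBl mulfK// gt_eqF.
rewrite ger0_norm ?divr_ge0 ?subr_ge0// ler_pdivrMr// mulVf ?gt_eqF//.
by move: h2; rewrite intrD; lra.
Qed.

Let cvg_quant y : quant ^~ y @ \oo --> y.
Proof.
apply/cvgrPdist_le => /= e e0; near=> n; apply: (le_trans (quant_near n y)).
apply: ltW; near: n; exact: (near_infty_natSinv_lt (PosNum e0)).
Unshelve. all: by end_near. Qed.

(** Round [y] down to the grid of mesh [1 / (n + 1)]: preimages become countable unions of
    rectangles, and continuity in [y] lets [n] tend to infinity. This is what makes entire functions
    measurable for the product sigma-algebra of the plane. *)
Lemma measurable_fun_caratheodory (g : X -> R -> R) :
  (forall y, measurable_fun [set: X] (g ^~ y)) ->
  (forall x, continuous (g x)) ->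
  measurable_fun [set: X * RM] (fun p => g p.1 p.2).
Proof.
move=> mg cg; apply: (@measurable_fun_cvg _ _ _ _ (fun n p => g p.1 (quant n p.2))).
  move=> n _ U mU; rewrite setTI.
  rewrite [X in measurable X](_ : _ = \bigcup_(k : int)
     ((g ^~ ((k%:~R : R) / n.+1%:R)) @^-1` U `*`
      [set y : RM | Num.floor (y * n.+1%:R) = k])); last first.
    apply/seteqP; split=> [[x y] /= Uxy|[x y] /= [k _ [/= Uk fk]]].
      by exists (Num.floor (y * n.+1%:R)).
    by rewrite /quant fk.
  apply: countable_bigcupT_measurable => [|k]; first exact: countableP.
  apply: measurableX.
    by rewrite -[X in measurable X]setTI; exact: mg.
  rewrite (_ : [set y | _] = `[(k%:~R / n.+1%:R : R), ((k + 1)%:~R / n.+1%:R : R)[%classic)//.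
  apply/seteqP; split => y /=; rewrite in_itv/= ler_pdivrMr// ltr_pdivlMr//.
    by move=> <-; exact: floor_itv.
  by move=> h; apply: floor_def.
move=> [x y] _ /=; exact: (cvg_comp (quant ^~ y) (g x) (@cvg_quant y) (@cg x y)).
Qed.

End MeasurableCaratheodory.

(** * Integration against a density *)

Section IntegralDensity.
Local Open Scope ereal_scope.
Context d (T : measurableType d) (R : realType).
Variables (nu mu : {measure set T -> \bar R}) (g : T -> R).
Hypothesis g0 : forall x, (0 <= g x)%R.
Hypothesis mg : measurable_fun [set: T] g.
Hypothesis nuE : forall A, measurable A -> nu A = \int[mu]_(x in A) (g x)%:E.

Import HBNNSimple.

(** Monotone convergence along simple functions reduces the claim to indicators, where it is
    [nuE]. *)
Lemma ge0_integral_density (f : T -> \bar R) : (forall x, 0 <= f x) ->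
  measurable_fun [set: T] f ->
  \int[nu]_x f x = \int[mu]_x (f x * (g x)%:E).
Proof.
move=> f0 mf; pose h := nnsfun_approx measurableT mf.
have mgE : measurable_fun [set: T] (EFin \o g) by exact/measurable_EFinP.
have -> : \int[nu]_x f x = lim (\int[nu]_x (EFin \o h n) x @[n --> \oo]).
  have fE x : setT x -> f x = lim ((EFin \o h n) x @[n --> \oo]).
    by move=> Ex; apply/esym/cvg_lim => //; exact: cvg_nnsfun_approx.
  under eq_integral => x /[!inE] /fE -> //.
  apply: monotone_convergence => //.
  - by move=> n; exact/measurable_EFinP.
  - by move=> n x Ex //=; rewrite lee_fin.
  - by move=> x Ex a b ab; rewrite lee_fin; exact/lefP/nd_nnsfun_approx.
have -> : \int[mu]_x (f x * (g x)%:E) =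
    lim (\int[mu]_x ((EFin \o h n) x * (g x)%:E) @[n --> \oo]).
  have fg x : setT x -> f x * (g x)%:E = lim (((EFin \o h n) x * (g x)%:E) @[n --> \oo]).
    move=> Ex; apply/esym/cvg_lim => //; apply: cvgeZr => //.
    exact: cvg_nnsfun_approx.
  under eq_integral => x /[!inE] /fg -> //.
  apply: monotone_convergence => [//| | |].
  - by move=> n; apply/emeasurable_funM => //; exact/measurable_EFinP.
  - by move=> n x Ex /=; rewrite mule_ge0 ?lee_fin.
  - move=> x Ex a b ab/=; rewrite lee_wpmul2r ?lee_fin//.
    exact/lefP/nd_nnsfun_approx.
suff suf n : \int[mu]_x ((EFin \o h n) x * (g x)%:E) = \int[nu]_x (EFin \o h n) x.
  by under [in RHS]eq_fun do rewrite suf.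
transitivity (\int[nu]_x
   (\sum_(y \in range (h n)) (y * \1_(h n @^-1` [set y]) x)%:E)); last first.
  by apply: eq_integral => t tE; rewrite /= fimfunE -fsumEFin.
have indich m r : measurable_fun [set: T] (fun x => (r * \1_(h m @^-1` [set r]) x)%:E).
  by apply: (measurable_comp measurableT) => //; exact: measurable_funM.
rewrite ge0_integral_fsum//; last by move=> m y Ey; exact: nnfun_muleindic_ge0.
transitivity (\int[mu]_x (\sum_(y \in range (h n))
    (y * \1_(h n @^-1` [set y]) x)%:E * (g x)%:E)).
  under [RHS]eq_integral => x xE.
    rewrite -ge0_mule_fsuml => [|y]; last exact: nnfun_muleindic_ge0.
    rewrite fsumEFin // -(fimfunE _ x); over.
  by [].
rewrite ge0_integral_fsum//; last 2 first.
  - by move=> y; apply: emeasurable_funM.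
  - move=> m y Ey; apply: mule_ge0; first exact: nnfun_muleindic_ge0.
    by rewrite lee_fin.
apply: eq_fsbigr => r rhn.
under [RHS]eq_integral do rewrite EFinM.
rewrite integralZl_indic_nnsfun => //.
under eq_integral do rewrite EFinM -muleA.
rewrite ge0_integralZl//.
- under eq_integral do rewrite muleC.
  rewrite (eq_integral ((EFin \o g) \_ (h n @^-1` [set r]))); last first.
    by move=> x xE; rewrite epatch_indic.
  by rewrite -integral_mkcondr setTI -nuE// integral_indic// setIT.
- by apply: emeasurable_funM => //; exact/measurable_EFinP.
- by move=> t Et; rewrite mule_ge0 ?lee_fin.
- by move: rhn; rewrite inE => -[t _ <-]; rewrite lee_fin.
Qed.

End IntegralDensity.

(** * Translations, shears and rotations preserve area *)

Section AreaPreserving.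
Context {R : realType}.
Local Notation RM := (measurableTypeR R).
Local Notation plane := (RM * RM)%type.
Local Notation mu := (@lebesgue_measure R).

Lemma lebesgue_measure_translation (a : R) (A : set RM) : measurable A ->
  mu ((fun x : R => x + a) @^-1` A) = mu A.
Proof.
move=> mA; have mf : measurable_fun [set: RM] (fun x : RM => (x + a : RM)).
  by apply: measurable_funD => //; exact: measurable_cst.
apply/esym; pose f : {mfun RM >-> RM} := HB.pack (fun x : RM => (x + a : RM))
  (isMeasurableFun.Build _ _ _ _ _ mf).
apply: (@lebesgue_measure_unique _ (pushforward mu f)) => //= _ [[u v]] _ <-.
rewrite /pushforward /= (_ : _ @^-1` _ = `]u - a, v - a]%classic).
  by rewrite !lebesgue_measure_itv/= !lte_fin ltrD2r -!EFinB opprB addrA subrK.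
by apply/seteqP; split=> x /=; rewrite !in_itv/= ltrBlDr lerBrDr.
Qed.

Definition area_preserving (phi : plane -> plane) :=
  measurable_fun [set: plane] phi /\
  forall A, measurable A -> area (phi @^-1` A) = area A.

Lemma area_preserving_comp phi psi : area_preserving phi ->
  area_preserving psi -> area_preserving (phi \o psi).
Proof.
move=> [mphi hphi] [mpsi hpsi]; split; first exact: measurableT_comp.
move=> A mA; rewrite comp_preimage hpsi ?hphi//.
by rewrite -[X in measurable X]setTI; exact: mphi.
Qed.

(** [area] integrates the measures of vertical sections, and the shear translates each of them. *)
Lemma area_preserving_sheary (tau : R -> R) : measurable_fun [set: RM] tau ->
  area_preserving (fun x : plane => (x.1, x.2 + tau x.1)).
Proof.
move=> mtau.
have mphi : measurable_fun [set: plane] (fun x : plane => (x.1, x.2 + tau x.1) : plane).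
  apply/measurable_fun_pair => /=; first exact: measurable_fst.
  apply: measurable_funD; first exact: measurable_snd.
  exact: measurableT_comp.
split=> // A mA; rewrite /area /product_measure1.
apply: eq_integral => x _ /=.
rewrite -[RHS](@lebesgue_measure_translation (tau x)); last exact: measurable_xsection.
congr (mu _); apply/seteqP; split=> y /=; rewrite /xsection /=; rewrite !inE//.
Qed.

Lemma area_preserving_shearx (tau : R -> R) : measurable_fun [set: RM] tau ->
  area_preserving (fun x : plane => (x.1 + tau x.2, x.2)).
Proof.
move=> mtau.
have mphi : measurable_fun [set: plane] (fun x : plane => (x.1 + tau x.2, x.2) : plane).
  apply/measurable_fun_pair => /=; last exact: measurable_snd.
  apply: measurable_funD; first exact: measurable_fst.
  exact: measurableT_comp.
(* Here it is the horizontal sections that are translated, so the product measure is first rewritten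
   in the other order of integration. *)
have areaE A : measurable A -> area A = (mu \x^ mu)%E A.
  move=> mA; apply: product_measure_unique => // B C mB mC.
  exact: product_measure2E.
split=> // A mA; rewrite !areaE//; last first.
  by rewrite -[X in measurable X]setTI; exact: mphi.
apply: eq_integral => y _ /=.
rewrite -[RHS](@lebesgue_measure_translation (tau y)); last exact: measurable_ysection.
congr (mu _); apply/seteqP; split=> x /=; rewrite /ysection /=; rewrite !inE//.
Qed.

Lemma area_preserving_translation (a : plane) :
  area_preserving (fun x => (x.1 + a.1, x.2 + a.2)).
Proof.
have h1 := @area_preserving_sheary (fun=> a.2) (measurable_cst _).
have h2 := @area_preserving_shearx (fun=> a.1) (measurable_cst _).
exact: (area_preserving_comp h1 h2).
Qed.

(** A rotation with [s != 0] is a product of three shears. *)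
Lemma area_preserving_rotation (c s : R) : c ^+ 2 + s ^+ 2 = 1 ->
  area_preserving (fun x => (c * x.1 - s * x.2, s * x.1 + c * x.2)).
Proof.
have mlin (t : R) : measurable_fun [set: RM] (fun x : RM => t * x : RM).
  exact: measurable_funM.
have rot c' s' : s' != 0 -> c' ^+ 2 + s' ^+ 2 = 1 ->
    area_preserving (fun x => (c' * x.1 - s' * x.2, s' * x.1 + c' * x.2)).
  (* For angle [theta] this is [- tan (theta / 2)]: the rotation is a horizontal shear by [t], a
     vertical one by [s'], and again the horizontal one. *)
  move=> s0 cs; pose t := (c' - 1) / s'.
  have hx := area_preserving_shearx (mlin t).
  have hy := area_preserving_sheary (mlin s').
  have := area_preserving_comp hx (area_preserving_comp hy hx).
  congr area_preserving; apply/funext => -[x y] /=; rewrite /t.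
  have s2 : s' * s' = 1 - c' * c' by rewrite -!expr2 -cs; ring.
  congr pair; last by field.
  suff : (x + (c' - 1) / s' * y +
      (c' - 1) / s' * (y + s' * (x + (c' - 1) / s' * y))) * s' =
    (c' * x - s' * y) * s' by move/(mulIf s0).
  have -> : (c' * x - s' * y) * s' = c' * x * s' - (s' * s') * y by ring.
  by rewrite s2; field.
have [->|s0] := eqVneq s 0; last exact: rot.
rewrite expr0n addr0 => /eqP; rewrite sqrf_eq1 => /orP[] /eqP ->.
  rewrite (_ : (fun x => _) = idfun); first by split=> //; exact: measurable_id.
  by apply/funext => -[x y] /=; rewrite !mul1r !mul0r subr0 add0r.
(* The half turn has sine 0, where [t] would divide by zero; it is the square of the quarter
   turn. *)
have h := rot 0 1 (oner_neq0 _).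
have := area_preserving_comp (h _) (h _); rewrite expr0n expr1n add0r.
move=> /(_ erefl erefl); congr area_preserving; apply/funext => -[x y] /=.
by congr pair; ring.
Qed.

Local Open Scope ereal_scope.

Lemma ge0_integral_area_preserving phi (f : plane -> \bar R) :
  area_preserving phi -> measurable_fun [set: plane] f ->
  (forall x, 0 <= f x) -> \int[area]_x f (phi x) = \int[area]_x f x.
Proof.
move=> [mphi hphi] mf f0.
pose m : {measure set plane -> \bar R} := (mu \x mu)%E.
have E := @ge0_integral_pushforward _ _ _ _ R phi mphi m setT f
  measurableT mf (fun x _ => f0 x).
rewrite preimage_setT in E.
apply: (etrans (esym E)).
by apply: eq_measure_integral => A mA _; exact: hphi.
Qed.

End AreaPreserving.

(** * Integrals of complex-valued functions *)

Section ComplexIntegral.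
Context d (T : measurableType d) {R : realType} (m : {measure set T -> \bar R}).
Implicit Types F G : T -> R[i].

Definition cmeasurable F :=
  measurable_fun [set: T] (fun x => complex.Re (F x)) /\
  measurable_fun [set: T] (fun x => complex.Im (F x)).

(** Componentwise, so that [fock_inner] is an instance by conversion. *)
Definition cintegral F : R[i] :=
  (\int[m]_x complex.Re (F x)) +i* (\int[m]_x complex.Im (F x)).

Definition cintegrable F :=
  cmeasurable F /\ (\int[m]_x (normc (F x))%:E < +oo)%E.

Lemma ReD (z w : R[i]) : complex.Re (z + w) = complex.Re z + complex.Re w.
Proof. by case: z => a b; case: w. Qed.

Lemma ImD (z w : R[i]) : complex.Im (z + w) = complex.Im z + complex.Im w.
Proof. by case: z => a b; case: w. Qed.

Lemma cmeasurable_cst c : cmeasurable (fun=> c).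
Proof. by split; exact: measurable_cst. Qed.

Lemma cmeasurableD F G : cmeasurable F -> cmeasurable G ->
  cmeasurable (fun x => F x + G x).
Proof.
move=> [rF iF] [rG iG]; split.
  by under eq_fun do rewrite ReD; exact: measurable_funD.
by under eq_fun do rewrite ImD; exact: measurable_funD.
Qed.

Lemma cmeasurableM F G : cmeasurable F -> cmeasurable G ->
  cmeasurable (fun x => F x * G x).
Proof.
move=> [rF iF] [rG iG]; split.
  under eq_fun do rewrite ReM.
  by apply: measurable_funB; exact: measurable_funM.
under eq_fun do rewrite ImM.
by apply: measurable_funD; exact: measurable_funM.
Qed.

Lemma cmeasurable_conj F : cmeasurable F -> cmeasurable (fun x => conjc (F x)).
Proof.
move=> [rF iF]; split.
  by rewrite (_ : (fun x => _) = fun x => complex.Re (F x))//;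
    apply/funext => x; case: (F x).
rewrite (_ : (fun x => _) = fun x => - complex.Im (F x)).
  exact: measurable_funN.
by apply/funext => x; case: (F x).
Qed.

Lemma cmeasurable_normc F : cmeasurable F ->
  measurable_fun [set: T] (fun x => normc (F x)).
Proof.
move=> [rF iF].
rewrite (_ : (fun x => _) = Num.sqrt \o
  (fun x => complex.Re (F x) ^+ 2 + complex.Im (F x) ^+ 2)); last first.
  by apply/funext => x /=; case: (F x).
apply: measurableT_comp.
  by apply: continuous_measurable_fun => ?; exact: sqrt_continuous.
by apply: measurable_funD; apply: measurable_funX.
Qed.

(** Serves for a derivative that depends on a parameter: it is a pointwise limit of measurable
    difference quotients. *)
Lemma cmeasurable_cvg (F_ : nat -> T -> R[i]) F :
  (forall n, cmeasurable (F_ n)) ->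
  (forall x (e : R), 0 < e -> exists N, forall n, (N <= n)%N ->
     normc (F_ n x - F x) <= e) -> cmeasurable F.
Proof.
move=> mF H; split.
  apply: (@measurable_fun_cvg _ _ _ _ (fun n x => complex.Re (F_ n x))).
    by move=> n; case: (mF n).
  move=> x _; apply/cvgrPdist_le => /= e e0; have [N HN] := H x e e0.
  exists N => // n /HN; apply: le_trans.
  by rewrite distrC -ReB le_normc_Re.
apply: (@measurable_fun_cvg _ _ _ _ (fun n x => complex.Im (F_ n x))).
  by move=> n; case: (mF n).
move=> x _; apply/cvgrPdist_le => /= e e0; have [N HN] := H x e e0.
exists N => // n /HN; apply: le_trans.
by rewrite distrC -ImB le_normc_Im.
Qed.

Lemma cintegrable_Re F : cintegrable F ->
  m.-integrable [set: T] (EFin \o (fun x => complex.Re (F x))).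
Proof.
move=> [mF oF]; apply/integrableP; split; first exact/measurable_EFinP/mF.1.
apply: le_lt_trans oF; apply: ge0_le_integral => //=.
- by apply/measurable_EFinP; apply: measurableT_comp => //; exact: mF.1.
- by apply/measurable_EFinP; exact: cmeasurable_normc.
- by move=> x _; rewrite lee_fin le_normc_Re.
Qed.

Lemma cintegrable_Im F : cintegrable F ->
  m.-integrable [set: T] (EFin \o (fun x => complex.Im (F x))).
Proof.
move=> [mF oF]; apply/integrableP; split; first exact/measurable_EFinP/mF.2.
apply: le_lt_trans oF; apply: ge0_le_integral => //=.
- by apply/measurable_EFinP; apply: measurableT_comp => //; exact: mF.2.
- by apply/measurable_EFinP; exact: cmeasurable_normc.
- by move=> x _; rewrite lee_fin le_normc_Im.
Qed.

Lemma cintegrable_dominated F (g : T -> R) : cmeasurable F ->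
  measurable_fun [set: T] g -> (forall x, normc (F x) <= g x) ->
  (\int[m]_x (g x)%:E < +oo)%E -> cintegrable F.
Proof.
move=> mF mg Fg og; split=> //; apply: le_lt_trans og.
apply: ge0_le_integral => //=.
- by move=> x _; rewrite lee_fin normc_ge0.
- by apply/measurable_EFinP; exact: cmeasurable_normc.
- exact/measurable_EFinP.
- by move=> x _; rewrite lee_fin.
Qed.

Lemma cintegrableD F G : cintegrable F -> cintegrable G ->
  cintegrable (fun x => F x + G x).
Proof.
move=> [mF oF] [mG oG].
apply: (@cintegrable_dominated _ (fun x => normc (F x) + normc (G x))).
- exact: cmeasurableD.
- by apply: measurable_funD; exact: cmeasurable_normc.
- by move=> x; exact: le_normcD.
under eq_integral do rewrite EFinD.
rewrite ge0_integralD//=; first exact: lte_add_pinfty.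
- by move=> x _; rewrite lee_fin normc_ge0.
- by apply/measurable_EFinP; exact: cmeasurable_normc.
- by move=> x _; rewrite lee_fin normc_ge0.
- by apply/measurable_EFinP; exact: cmeasurable_normc.
Qed.

Lemma cintegrableZ c F : cintegrable F -> cintegrable (fun x => c * F x).
Proof.
move=> [mF oF]; split.
  by apply: cmeasurableM => //; exact: cmeasurable_cst.
under eq_integral do rewrite normcM EFinM.
rewrite ge0_integralZl//=.
- by rewrite lte_mul_pinfty// ?lee_fin ?normc_ge0.
- by apply/measurable_EFinP; exact: cmeasurable_normc.
- by move=> x _; rewrite lee_fin normc_ge0.
- by rewrite lee_fin normc_ge0.
Qed.

Lemma cintegralD F G : cintegrable F -> cintegrable G ->
  cintegral (fun x => F x + G x) = cintegral F + cintegral G.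
Proof.
move=> iF iG; rewrite /cintegral; apply/eqP; rewrite eq_complex; apply/andP.
rewrite ReD ImD /=; split; apply/eqP.
  rewrite -RintegralD//; [|exact: cintegrable_Re..].
  by apply: eq_Rintegral => x _; rewrite ReD.
rewrite -RintegralD//; [|exact: cintegrable_Im..].
by apply: eq_Rintegral => x _; rewrite ImD.
Qed.

Lemma cintegralZ c F : cintegrable F ->
  cintegral (fun x => c * F x) = c * cintegral F.
Proof.
move=> iF; have rF := cintegrable_Re iF; have jF := cintegrable_Im iF.
have rZ k : m.-integrable [set: T] (EFin \o (fun x => k * complex.Re (F x))).
  by rewrite /comp; under eq_fun do rewrite EFinM; exact: integrableZl.
have iZ k : m.-integrable [set: T] (EFin \o (fun x => k * complex.Im (F x))).
  by rewrite /comp; under eq_fun do rewrite EFinM; exact: integrableZl.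
rewrite /cintegral; apply/eqP; rewrite eq_complex; apply/andP.
rewrite ReM ImM /=; split; apply/eqP.
  rewrite -!RintegralZl// -RintegralB//.
  by apply: eq_Rintegral => x _; rewrite ReM.
rewrite -!RintegralZl// -RintegralD//.
by apply: eq_Rintegral => x _; rewrite ImM.
Qed.

(** The factor 2 (not sharp) comes from [|z| <= |Re z| + |Im z|]. *)
Lemma normc_cintegral F : cintegrable F ->
  ((normc (cintegral F))%:E <= 2%:E * \int[m]_x (normc (F x))%:E)%E.
Proof.
move=> iF; have [mF oF] := iF.
have mN : measurable_fun [set: T] (fun x => (normc (F x))%:E).
  by apply/measurable_EFinP; exact: cmeasurable_normc.
have -> : (2%:E = 1 + 1 :> \bar R)%E by rewrite -EFinD.
rewrite ge0_muleDl// mul1e.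
apply: (@le_trans _ _ (`|complex.Re (cintegral F)| + `|complex.Im (cintegral F)|)%:E).
  by rewrite lee_fin; exact: normc_le_ReIm.
rewrite EFinD /cintegral /=; apply: leeD.
  rewrite EFin_normr_Rintegral//; last exact: cintegrable_Re.
  apply: (le_trans (le_abse_integral _ _ _)) => //.
    exact/measurable_EFinP/mF.1.
  apply: ge0_le_integral => //=.
  - by apply/measurable_EFinP; apply: measurableT_comp => //; exact: mF.1.
  - by move=> x _; rewrite lee_fin le_normc_Re.
rewrite EFin_normr_Rintegral//; last exact: cintegrable_Im.
apply: (le_trans (le_abse_integral _ _ _)) => //.
  exact/measurable_EFinP/mF.2.
apply: ge0_le_integral => //=.
- by apply/measurable_EFinP; apply: measurableT_comp => //; exact: mF.2.
- by move=> x _; rewrite lee_fin le_normc_Im.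
Qed.

End ComplexIntegral.

(** * Weighted changes of variables, from nonnegative to complex functions *)

Section WeightedPushforward.
Context d (T : measurableType d) {R : realType} (m : {measure set T -> \bar R}).
Variables (phi : T -> T) (w : T -> R).
Hypothesis w0 : forall x, 0 <= w x.
Hypothesis phiE : forall f : T -> \bar R, measurable_fun [set: T] f ->
  (forall x, 0 <= f x)%E -> (\int[m]_x f x = \int[m]_x (f (phi x) * (w x)%:E))%E.

(** Multiplication by a nonnegative weight commutes with positive and negative parts, so the two
    halves of the integral transform separately and integrability is irrelevant. *)
Lemma integral_weighted_pushforward (f : T -> R) : measurable_fun [set: T] f ->
  (\int[m]_x (f x)%:E = \int[m]_x (f (phi x) * w x)%:E)%E.
Proof.
move=> mf; have mfE : measurable_fun [set: T] (EFin \o f) by exact/measurable_EFinP.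
rewrite integralE [RHS]integralE; congr (_ - _)%E.
  rewrite phiE; last 2 first.
  - exact: measurable_funepos.
  - by move=> x; exact: funepos_ge0.
  apply: eq_integral => x _; rewrite !funeposE /= -!EFin_max -EFinM.
  by congr EFin; rewrite [in LHS]maxr_pMl// mul0r.
rewrite phiE; last 2 first.
- exact: measurable_funeneg.
- by move=> x; exact: funeneg_ge0.
apply: eq_integral => x _; rewrite !funenegE /= -!EFin_max -EFinM.
by congr EFin; rewrite [in LHS]maxr_pMl// mul0r mulNr.
Qed.

Lemma Rintegral_weighted_pushforward (f : T -> R) : measurable_fun [set: T] f ->
  \int[m]_x f x = \int[m]_x (f (phi x) * w x).
Proof. by move=> mf; congr fine; exact: integral_weighted_pushforward. Qed.

Lemma cintegral_weighted_pushforward (F : T -> R[i]) : cmeasurable F ->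
  cintegral m F = cintegral m (fun x => F (phi x) * (w x)%:C).
Proof.
move=> [rF iF]; rewrite /cintegral; congr (_ +i* _).
  rewrite Rintegral_weighted_pushforward//; apply: eq_Rintegral => x _.
  by rewrite ReM /= mulr0 subr0.
rewrite Rintegral_weighted_pushforward//; apply: eq_Rintegral => x _.
by rewrite ImM /= mulr0 add0r.
Qed.

End WeightedPushforward.

(** * The Gaussian probability measure and its symmetries *)

Section FockMeasure.
Context {R : realType}.
Local Notation RM := (measurableTypeR R).
Local Notation plane := (RM * RM)%type.
Local Notation mu := (@lebesgue_measure R).
Implicit Types alpha : {posnum R}.

Lemma sqr_normc_toC (x : plane) : normc (toC x) ^+ 2 = x.1 ^+ 2 + x.2 ^+ 2.
Proof. by rewrite sqr_normc. Qed.

Lemma measurable_gauss alpha : measurable_fun [set: plane] (gauss_density alpha).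
Proof. by apply/measurable_EFinP; exact: measurable_gauss_density. Qed.

Lemma ge0_fock_integralE alpha (f : plane -> \bar R) :
  measurable_fun [set: plane] f -> (forall x, 0 <= f x)%E ->
  (\int[fock_measure alpha]_x f x =
   \int[area]_x (f x * (gauss_density alpha x)%:E))%E.
Proof.
move=> mf f0; apply: ge0_integral_density => //.
- by move=> x; have := gauss_density_ge0 alpha x; rewrite lee_fin.
- exact: measurable_gauss.
Qed.

(** The two coordinates are independent centred normal variables of variance [1 / (2 alpha)]; this
    reduces the total mass to the one-dimensional normal law. *)
Lemma gauss_densityE alpha (s := Num.sqrt (2 * alpha%:num)^-1) x :
  gauss_density alpha x = normal_pdf 0 s x.1 * normal_pdf 0 s x.2.
Proof.
have a0 : 0 < alpha%:num by [].
have s2 : s ^+ 2 = (2 * alpha%:num)^-1.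
  by rewrite sqr_sqrtr// invr_ge0 mulr_ge0.
have s0 : s != 0 by rewrite gt_eqF// sqrtr_gt0 invr_gt0 mulr_gt0.
rewrite !normal_pdfE// /normal_peak /normal_fun s2 !subr0.
rewrite mulrACA -expRD -expr2 exprVn sqr_sqrtr; last first.
  by rewrite mulrn_wge0// mulr_ge0 ?pi_ge0// invr_ge0 mulr_ge0.
rewrite /gauss_density sqr_normc_toC; congr (_ * expR _).
  have := pi_gt0 R; move: (pi : R) => p p0.
  by field; rewrite !gt_eqF.
by field; rewrite ?gt_eqF.
Qed.

Lemma fock_measure_setT alpha : fock_measure alpha [set: plane] = 1%E.
Proof.
rewrite /fock_measure.
rewrite fubini_tonelli1//; last 2 first.
- exact: measurable_gauss_density.
- exact: gauss_density_ge0.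
pose s := Num.sqrt (2 * alpha%:num)^-1.
transitivity (\int[mu]_x (normal_pdf 0 s x)%:E)%E; last exact: integral_normal_pdf.
apply: eq_integral => x _; rewrite /fubini_F.
under eq_integral do rewrite gauss_densityE EFinM /=.
rewrite ge0_integralZl//=; last 3 first.
- by apply/measurable_EFinP; exact: measurable_normal_pdf.
- by move=> y _; rewrite lee_fin normal_pdf_ge0.
- by rewrite lee_fin normal_pdf_ge0.
by rewrite integral_normal_pdf mule1.
Qed.

(** Supplies the sigma-finiteness required by the later uses of Fubini's theorem. *)
HB.instance Definition _ alpha :=
  @Measure_isProbability.Build _ _ R (fock_measure alpha) (fock_measure_setT alpha).

Lemma fock_rotation alpha (c s : R) (f : plane -> \bar R) :
  c ^+ 2 + s ^+ 2 = 1 ->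
  measurable_fun [set: plane] f -> (forall x, 0 <= f x)%E ->
  (\int[fock_measure alpha]_x f ((c * x.1 - s * x.2)%R, (s * x.1 + c * x.2)%R) =
  \int[fock_measure alpha]_x f x)%E.
Proof.
move=> cs mf f0; have hrot := area_preserving_rotation cs.
rewrite !ge0_fock_integralE//; last by apply: measurableT_comp => //; exact: hrot.1.
rewrite -[RHS](ge0_integral_area_preserving hrot); last 2 first.
- by apply: emeasurable_funM => //; exact: measurable_gauss_density.
- by move=> x; rewrite mule_ge0// gauss_density_ge0.
apply: eq_integral => x _; congr (_ * (_ * expR (- (_ * _)))%:E)%E.
rewrite !sqr_normc_toC /=.
have -> : (c * x.1 - s * x.2) ^+ 2 + (s * x.1 + c * x.2) ^+ 2 =
  (c ^+ 2 + s ^+ 2) * (x.1 ^+ 2 + x.2 ^+ 2) by ring.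
by rewrite cs mul1r.
Qed.

(** The quotient [gauss_density (x + a) / gauss_density x]. *)
Definition translation_weight alpha (a x : plane) : R :=
  expR (- (2 * alpha%:num * (a.1 * x.1 + a.2 * x.2))
        - alpha%:num * normc (toC a) ^+ 2).

Lemma measurable_translation_weight alpha a :
  measurable_fun [set: plane] (translation_weight alpha a).
Proof.
apply: measurableT_comp => //; apply: measurable_funB => //.
apply: measurable_funN; apply: measurable_funM => //.
by apply: measurable_funD; apply: measurable_funM.
Qed.

Lemma fock_translation alpha a (f : plane -> \bar R) :
  measurable_fun [set: plane] f -> (forall x, 0 <= f x)%E ->
  (\int[fock_measure alpha]_x f x =
  \int[fock_measure alpha]_x
    (f ((x.1 + a.1)%R, (x.2 + a.2)%R) * (translation_weight alpha a x)%:E))%E.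
Proof.
move=> mf f0; have htr := area_preserving_translation a.
rewrite !ge0_fock_integralE//; last 2 first.
- apply: emeasurable_funM.
    by apply: measurableT_comp => //; exact: htr.1.
  by apply/measurable_EFinP; exact: measurable_translation_weight.
- by move=> x; rewrite mule_ge0// lee_fin expR_ge0.
rewrite -[LHS](ge0_integral_area_preserving htr); last 2 first.
- by apply: emeasurable_funM => //; exact: measurable_gauss_density.
- by move=> x; rewrite mule_ge0// gauss_density_ge0.
apply: eq_integral => x _; rewrite -muleA; congr (_ * _)%E.
rewrite -EFinM /gauss_density /translation_weight [in RHS]mulrCA -expRD.
congr (_ * expR _)%:E; rewrite !sqr_normc_toC /=; ring.
Qed.

Lemma measurable_gaussian (c : R) :
  measurable_fun [set: plane] (fun x : plane => expR (c * normc (toC x) ^+ 2)).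
Proof.
apply: measurableT_comp => //; under eq_fun do rewrite sqr_normc_toC.
apply: measurable_funM => //; apply: measurable_funD; apply: measurable_funX.
  exact: measurable_fst.
exact: measurable_snd.
Qed.

(** The integrand times the density of parameter [alpha] is [alpha / (alpha - c)] times the density
    of parameter [alpha - c], which has mass 1. *)
Lemma fock_gaussian alpha (c : R) : c < alpha%:num ->
  (\int[fock_measure alpha]_x (expR (c * normc (toC x) ^+ 2))%:E =
   (alpha%:num / (alpha%:num - c))%:E)%E.
Proof.
move=> ca; have b0 : 0 < alpha%:num - c by rewrite subr_gt0.
pose beta := PosNum b0.
rewrite ge0_fock_integralE; last 2 first.
- by apply/measurable_EFinP; exact: measurable_gaussian.
- by move=> x; rewrite lee_fin expR_ge0.
rewrite -[RHS]mule1 -(fock_measure_setT beta) /fock_measure.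
rewrite -ge0_integralZl//=; last 3 first.
- exact: measurable_gauss_density.
- by move=> x _; exact: gauss_density_ge0.
- by rewrite lee_fin divr_ge0// ltW.
apply: eq_integral => x _; rewrite -!EFinM; congr EFin.
rewrite /gauss_density /= [LHS]mulrCA -expRD.
rewrite mulrA; congr (_ * expR _); last by ring.
by have := pi_gt0 R; move: (pi : R) => p p0; field; rewrite !gt_eqF.
Qed.

End FockMeasure.

(** * Reproducing formula and pointwise estimates *)

Section MeanValue.
Context {R : realType}.
Local Notation RM := (measurableTypeR R).
Local Notation plane := (RM * RM)%type.
Local Notation mu := (@lebesgue_measure R).
Implicit Types (alpha : {posnum R}) (f : R[i] -> R[i]).

Lemma entire_measurable f : entire f -> cmeasurable (fun x : plane => f (toC x)).
Proof.
move=> ef; split.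
  apply: (@measurable_fun_caratheodory _ RM R (fun x y => complex.Re (f (x +i* y)))).
    by move=> y; apply: continuous_measurable_fun; exact: entire_continuous_Rex.
  by move=> x; exact: entire_continuous_Rey.
apply: (@measurable_fun_caratheodory _ RM R (fun x y => complex.Im (f (x +i* y)))).
  by move=> y; apply: continuous_measurable_fun; exact: entire_continuous_Imx.
by move=> x; exact: entire_continuous_Imy.
Qed.

Lemma toC_rotation (x : plane) (t : R) : toC x * cexp (0 +i* t) =
  toC (cos t * x.1 - sin t * x.2, sin t * x.1 + cos t * x.2).
Proof.
rewrite /cexp /toC /= expR0; apply/eqP; rewrite eq_complex /=.
by apply/andP; split; apply/eqP; ring.
Qed.

Local Open Scope ereal_scope.

(** Average over all rotations, by Fubini, and apply [circle_mean]. *)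
Let mean_Re alpha f : entire f ->
  cintegrable (fock_measure alpha) (fun x => f (toC x)) ->
  \int[fock_measure alpha]_x (complex.Re (f (toC x)))%:E = (complex.Re (f 0))%:E.
Proof.
move=> ef intf; pose lam := fock_measure alpha.
pose D : set RM := `[0%R, (pi *+ 2)%R]%classic.
pose rot t (x : plane) : plane :=
  ((cos t * x.1 - sin t * x.2)%R, (sin t * x.1 + cos t * x.2)%R).
have pi0 : (0 < pi *+ 2 :> R)%R by rewrite mulrn_wgt0// pi_gt0.
have muD : mu D = (pi *+ 2)%:E.
  by rewrite lebesgue_measure_itv/= lte_fin pi0 oppr0 adde0.
pose g x := complex.Re (f (toC x)).
have mg : measurable_fun [set: plane] g by have [] := entire_measurable ef.
(* The indicator restricts the angle to one period while Fubini's theorem runs over the full product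
   space. *)
pose F (p : plane * RM) := (g (rot p.2 p.1) * \1_D p.2)%:E.
have mrot t : measurable_fun [set: plane] (rot t).
  by apply/measurable_fun_pair => /=; [apply: measurable_funB|apply: measurable_funD];
    apply: measurable_funM.
have mrot2 : measurable_fun [set: plane * RM] (fun p : plane * RM => rot p.2 p.1).
  have mc : measurable_fun [set: plane * RM] (fun p : plane * RM => cos p.2).
    apply: measurableT_comp => //; apply: continuous_measurable_fun.
    exact: continuous_cos.
  have ms : measurable_fun [set: plane * RM] (fun p : plane * RM => sin p.2).
    apply: measurableT_comp => //; apply: continuous_measurable_fun.
    exact: continuous_sin.
  have m1 : measurable_fun [set: plane * RM] (fun p : plane * RM => p.1.1).
    by apply: (measurableT_comp measurable_fst); exact: measurable_fst.
  have m2 : measurable_fun [set: plane * RM] (fun p : plane * RM => p.1.2).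
    by apply: (measurableT_comp measurable_snd); exact: measurable_fst.
  by apply/measurable_fun_pair => /=; [apply: measurable_funB|apply: measurable_funD];
    apply: measurable_funM.
have mD : measurable D by exact: measurable_itv.
have mF : measurable_fun [set: plane * RM] F.
  apply/measurable_EFinP; apply: measurable_funM; first exact: measurableT_comp.
  exact: (@measurableT_comp _ _ _ _ _ _ (\1_D : RM -> R) _ snd).
have cs (t : R) : (cos t ^+ 2 + sin t ^+ 2 = 1)%R by exact: cos2Dsin2.
pose N := \int[lam]_x (`|g x|)%:E.
have N0 : 0 <= N by apply: integral_ge0 => x _; rewrite lee_fin.
have Noo : N < +oo.
  by have /integrableP[_] := cintegrable_Re intf.
(* By rotation invariance the inner integral of [|F|] is [N] for angles in [D] and 0 elsewhere, so
   the double integral is [2 pi N]. *)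
have intF : (lam \x mu).-integrable [set: plane * RM] F.
  apply/integrable21ltyP => //.
  rewrite (eq_integral (fun t => N * (\1_D t)%:E)); last first.
    move=> t _; under eq_integral do rewrite /F /= normrM EFinM.
    rewrite ge0_integralZr//=; last first.
      apply/measurable_EFinP; apply: measurableT_comp => //.
      exact: measurableT_comp.
    rewrite ger0_norm//; congr (_ * _).
    apply: (fock_rotation alpha (cs t) (f := fun x => `|g x|%:E)).
      by apply/measurable_EFinP; exact: measurableT_comp.
    by move=> x; rewrite lee_fin.
  rewrite ge0_integralZl//=; last first.
    by apply/measurable_EFinP; exact: measurable_indic.
  by rewrite integral_indic//= setIT muD lte_mul_pinfty// ?ltry ?ge0_fin_numE.
have := Fubini intF.
set I := (X in _ -> X = _).
have Ifin : I \is a fin_num.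
  by have := integrable_fin_num measurableT (cintegrable_Re intf).
(* Angle first: by [circle_mean] the inner integral does not depend on [x], and the Gaussian measure
   has mass 1. *)
rewrite (eq_integral (fun=> (complex.Re (f 0) * (pi *+ 2))%:E)); last first.
  move=> x _; rewrite -(circle_mean (toC x) ef) /Rintegral fineK; last first.
    have ct := @entire_continuous_Rey R (fun z => f (toC x * cexp z)%R) 0%R
      (entire_comp ef (entireM (@entire_cst R _) (@entire_cexp R))).
    exact: (integrable_fin_num mD
      (continuous_integrable_itv 0%R (pi *+ 2)%R ct)).
  rewrite [RHS]integral_mkcond; apply: eq_integral => t _.
  rewrite /F /g /= patchE -toC_rotation indicE.
  by case: ifP => _; rewrite ?mulr1// mulr0.
rewrite integral_cst//= [X in _ * X](fock_measure_setT alpha) mule1.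
(* Plane first: each rotation in [D] leaves the integral equal to [I]. Comparing the two orders and
   cancelling [2 pi] gives the claim. *)
rewrite (eq_integral (fun t => I * (\1_D t)%:E)); last first.
  move=> t _; rewrite /F /=; under eq_integral do rewrite EFinM.
  have rotI : \int[lam]_x (g (rot t x))%:E = I.
    rewrite /I (@integral_weighted_pushforward _ _ _ lam (rot t) (cst 1%R)
        (fun=> ler01) _ g mg).
      by apply: eq_integral => x _; rewrite /= mulr1.
    move=> h mh h0; rewrite -(fock_rotation alpha (cs t) mh h0).
    by apply: eq_integral => x _; rewrite mule1.
  have irot : lam.-integrable [set: plane] (fun x => (g (rot t x))%:E).
    apply/integrableP; split; first by apply/measurable_EFinP; exact: measurableT_comp.
    rewrite (_ : \int[_]_x _ = N)//.
    apply: (fock_rotation alpha (cs t) (f := fun x => `|g x|%:E)).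
      by apply/measurable_EFinP; exact: measurableT_comp.
    by move=> x; rewrite lee_fin.
  by rewrite integralZr// rotI.
rewrite -(fineK Ifin) integralZl//; last first.
  exact: integrable_indic_itv.
have -> : \int[mu]_t (\1_D t)%:E = (pi *+ 2)%:E by rewrite integral_indic// setIT.
rewrite -EFinM => -[] /mulIf ->//.
by rewrite gt_eqF.
Qed.

Local Close Scope ereal_scope.

Lemma fock_mean alpha f : entire f ->
  cintegrable (fock_measure alpha) (fun x => f (toC x)) ->
  cintegral (fock_measure alpha) (fun x => f (toC x)) = f 0.
Proof.
move=> ef intf; apply/eqP; rewrite eq_complex; apply/andP; split; apply/eqP.
  by rewrite /cintegral /= /Rintegral mean_Re.
(* The imaginary part is the real case applied to [- i f]. *)
pose c : R[i] := 0 -i* 1.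
have := mean_Re (entireM (@entire_cst R c) ef) (cintegrableZ c intf).
have ImE (z : R[i]) : complex.Re (c * z) = complex.Im z.
  by case: z => a b /=; ring.
rewrite ImE => H; rewrite -[RHS](congr1 fine H) /cintegral /Rintegral /=.
by congr fine; apply: eq_integral => x _; rewrite ImE.
Qed.

End MeanValue.

(** * Elements of the Fock space and the reproducing formula *)

Section FockSpaceTheory.
Context {R : realType}.
Local Notation RM := (measurableTypeR R).
Local Notation plane := (RM * RM)%type.
Implicit Types (alpha : {posnum R}) (f g : R[i] -> R[i]) (z w : R[i]).

Definition ofC z : plane := (complex.Re z, complex.Im z).

Lemma ofCK z : toC (ofC z) = z.
Proof. by case: z. Qed.

(** The real part of [z * conjc w], hence, up to [alpha], the logarithm of the modulus of the
    kernel. *)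
Definition dotC z w : R :=
  complex.Re z * complex.Re w + complex.Im z * complex.Im w.

Lemma dotC_le (t : R) z w : 0 < t ->
  2 * dotC z w <= t^-1 * normc z ^+ 2 + t * normc w ^+ 2.
Proof.
move=> t0; rewrite !sqr_normc /dotC.
have H a b : 2 * (a * b) <= t^-1 * a ^+ 2 + t * b ^+ 2.
  rewrite -subr_ge0.
  have -> : t^-1 * a ^+ 2 + t * b ^+ 2 - 2 * (a * b) = t^-1 * (a - t * b) ^+ 2.
    by field; rewrite gt_eqF.
  by rewrite mulr_ge0 ?sqr_ge0// invr_ge0 ltW.
by rewrite !mulrDr addrACA; apply: lerD.
Qed.

Lemma normc_fock_kernel alpha w z :
  normc (fock_kernel alpha w z) = expR (alpha%:num * dotC z w).
Proof.
rewrite normc_cexp; congr expR.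
by case: z => a b; case: w => c d; rewrite /dotC /=; ring.
Qed.

Lemma entire_fock_kernel alpha w : entire (fock_kernel alpha w).
Proof.
have h : entire (fun z => alpha%:num%:C * z * conjc w).
  exact: (entireM (entireM (@entire_cst R _) (@entire_id R)) (@entire_cst R _)).
exact: (entire_comp (@entire_cexp R) h).
Qed.

Lemma poweR_fock_norm alpha (p : R) f : p != 0 ->
  (fock_norm alpha p f `^ p =
   \int[fock_measure alpha]_x ((normc (f (toC x)) `^ p)%:E))%E.
Proof.
move=> p0; apply: (etrans (poweR_Lnorm _ _ p0)); apply: eq_integral => x _ /=.
by rewrite ger0_norm ?normc_ge0.
Qed.

(** The squared norm as a plain integral, free of real powers; the estimates are made for it and
    roots are taken only at the end. *)
Definition sqnorm alpha f : \bar R :=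
  (\int[fock_measure alpha]_x (normc (f (toC x)) ^+ 2)%:E)%E.

Lemma fock_norm_sqr alpha f : (fock_norm alpha 2 f `^ 2 = sqnorm alpha f)%E.
Proof.
rewrite poweR_fock_norm ?pnatr_eq0//; apply: eq_integral => x _.
by rewrite powR_mulrn// normc_ge0.
Qed.

Lemma fockP alpha f : fock alpha f <-> entire f /\ (sqnorm alpha f < +oo)%E.
Proof.
rewrite -fock_norm_sqr; split=> -[ef] h; split=> //; first exact: poweR_lty.
by apply: lty_poweRy h; rewrite pnatr_eq0.
Qed.

Lemma measurable_sqnormc f : entire f ->
  measurable_fun [set: plane] (fun x => normc (f (toC x)) ^+ 2).
Proof.
move=> ef; apply: measurable_funX; apply: cmeasurable_normc.
exact: entire_measurable.
Qed.

Lemma fock_of_gaussian_bound alpha f (M c : R) : entire f ->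
  2 * c < alpha%:num -> (forall z, normc (f z) <= M * expR (c * normc z ^+ 2)) ->
  fock alpha f.
Proof.
move=> ef ca fM; apply/fockP; split=> //.
apply: (@le_lt_trans _ _ (\int[fock_measure alpha]_x
   ((M ^+ 2)%:E * (expR (2 * c * normc (toC x) ^+ 2))%:E))%E).
  apply: ge0_le_integral => //=.
  - by move=> x _; rewrite lee_fin sqr_ge0.
  - by apply/measurable_EFinP; exact: measurable_sqnormc.
  - apply: emeasurable_funM; first exact: measurable_cst.
    by apply/measurable_EFinP; exact: measurable_gaussian.
  - move=> x _; rewrite -EFinM lee_fin.
    have n0 := normc_ge0 (f (toC x)); have r0 := le_trans n0 (fM (toC x)).
    apply: (@le_trans _ _ ((M * expR (c * normc (toC x) ^+ 2)) ^+ 2)).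
      by rewrite lerXn2r ?nnegrE.
    by rewrite exprMn -expRM_natl !mulrA.
rewrite ge0_integralZl ?lee_fin ?sqr_ge0//; last first.
  by apply/measurable_EFinP; exact: measurable_gaussian.
by rewrite fock_gaussian// -EFinM ltry.
Qed.

Lemma fock_fock_kernel alpha w : fock alpha (fock_kernel alpha w).
Proof.
apply: (@fock_of_gaussian_bound _ _ (expR (alpha%:num * 2 * normc w ^+ 2))
  (alpha%:num / 8)).
- exact: entire_fock_kernel.
- have : 0 < alpha%:num by []. lra.
move=> z; rewrite normc_fock_kernel -expRD ler_expR.
(* With this weight the coefficient of [|z|^2] is [alpha / 8], safely below the threshold
   [alpha / 2] of square integrability. *)
have t0 : 0 < 4^-1 :> R by rewrite invr_gt0.
have := dotC_le w z t0; rewrite invrK => h.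
have -> : alpha%:num * 2 * normc w ^+ 2 + alpha%:num / 8 * normc z ^+ 2 =
  alpha%:num * ((4 * normc w ^+ 2 + 4^-1 * normc z ^+ 2) / 2) by field.
rewrite ler_pM2l// ler_pdivlMr//; apply: le_trans h.
by rewrite /dotC le_eqVlt; apply/orP; left; apply/eqP; ring.
Qed.

Lemma fock_cintegrable alpha f g : fock alpha f -> fock alpha g ->
  cintegrable (fock_measure alpha) (fun x => f (toC x) * conjc (g (toC x))).
Proof.
move=> /fockP[ef of_] /fockP[eg og].
apply: (@cintegrable_dominated _ _ _ _ _
  (fun x => normc (f (toC x)) ^+ 2 + normc (g (toC x)) ^+ 2)).
- apply: cmeasurableM; first exact: entire_measurable.
  by apply: cmeasurable_conj; exact: entire_measurable.
- by apply: measurable_funD; exact: measurable_sqnormc.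
- move=> x; rewrite normcM normcJ.
  by have := normc_ge0 (f (toC x)); have := normc_ge0 (g (toC x)); nra.
under eq_integral do rewrite EFinD.
rewrite ge0_integralD//=; first exact: lte_add_pinfty.
- by move=> x _; rewrite lee_fin sqr_ge0.
- by apply/measurable_EFinP; exact: measurable_sqnormc.
- by move=> x _; rewrite lee_fin sqr_ge0.
- by apply/measurable_EFinP; exact: measurable_sqnormc.
Qed.

Lemma toC_translate (x : plane) z : toC (x.1 + (ofC z).1, x.2 + (ofC z).2) = z + toC x.
Proof.
by case: z => a b; rewrite /toC /ofC /=; apply/eqP; rewrite eq_complex /= ![a + _]addrC
  ![b + _]addrC !eqxx.
Qed.

Lemma translation_weightE alpha z x : translation_weight alpha (ofC z) x =
  expR (- (2 * alpha%:num * dotC z (toC x)) - alpha%:num * normc z ^+ 2).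
Proof. by rewrite /translation_weight ofCK. Qed.

Lemma fock_translationC alpha z (h : R[i] -> \bar R) :
  measurable_fun [set: plane] (h \o toC) -> (forall w, 0 <= h w)%E ->
  (\int[fock_measure alpha]_x h (toC x) =
  \int[fock_measure alpha]_x (h (z + toC x)%R
   * (expR (- (2 * alpha%:num * dotC z (toC x)) - alpha%:num * normc z ^+ 2))%:E))%E.
Proof.
move=> mh h0.
rewrite (@fock_translation R alpha (ofC z) (fun x => h (toC x)) mh (fun x => h0 _)).
by apply: eq_integral => x _; rewrite translation_weightE /= toC_translate.
Qed.

(** The translation by [z] turns the integrand, weight included, into the entire function
    [h u = f (z + u) e^(- alpha (conj z) u)]: the antiholomorphic part of the kernel cancels. The
    mean of [h] is [h 0 = f z]. *)
Lemma fock_reproducing alpha f z : fock alpha f ->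
  fock_inner alpha f (fock_kernel alpha z) = f z.
Proof.
move=> ff; have [ef _] := ff.
pose F (x : plane) := f (toC x) * conjc (fock_kernel alpha z (toC x)).
have iF : cintegrable (fock_measure alpha) F.
  exact: (fock_cintegrable ff (fock_fock_kernel alpha z)).
pose h u := f (z + u) * cexp (- (alpha%:num%:C * conjc z) * u).
have eh : entire h.
  apply: entireM.
    exact: (entire_comp ef (entireD (@entire_cst R z) (@entire_id R))).
  exact: (entire_comp (@entire_cexp R) (entireM (@entire_cst R _) (@entire_id R))).
have FhE x : F (x.1 + (ofC z).1, x.2 + (ofC z).2) *
    (translation_weight alpha (ofC z) x)%:C = h (toC x).
  rewrite /F translation_weightE toC_translate /h -mulrA; congr (_ * _).
  rewrite /fock_kernel conjc_cexp -cexp_real -cexpD; congr cexp.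
  rewrite sqr_normc /dotC.
  case: (toC x) => a b; case: z {h eh F iF} => c d; apply/eqP.
  by rewrite eq_complex /=; apply/andP; split; apply/eqP; ring.
have trE := @fock_translation R alpha (ofC z).
have w0 x : 0 <= translation_weight alpha (ofC z) x by exact: expR_ge0.
have ih : cintegrable (fock_measure alpha) (fun x => h (toC x)).
  split; first exact: entire_measurable.
  case: iF => mF; rewrite trE; last 2 first.
  - by apply/measurable_EFinP; exact: cmeasurable_normc.
  - by move=> x; rewrite lee_fin normc_ge0.
  have NE x : normc (h (toC x)) = normc (F (x.1 + (ofC z).1, x.2 + (ofC z).2)) *
      translation_weight alpha (ofC z) x.
    rewrite -FhE; have := w0 x; move: (F _) (translation_weight _ _ _) => u v v0.
    by rewrite normcM normc_real ger0_norm.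
  move=> oF; apply: le_lt_trans oF; rewrite le_eqVlt; apply/orP; left; apply/eqP.
  by apply: eq_integral => x _; rewrite NE EFinM.
transitivity (cintegral (fock_measure alpha) F) => //.
rewrite (cintegral_weighted_pushforward w0 trE iF.1).
transitivity (cintegral (fock_measure alpha) (fun x => h (toC x))).
  by congr cintegral; apply/funext => x; exact: FhE.
by rewrite fock_mean// /h addr0 mulr0 cexp0 mulr1.
Qed.

End FockSpaceTheory.

(** * Pointwise bounds from integral norms *)

Section FockEstimates.
Context {R : realType}.
Local Notation RM := (measurableTypeR R).
Local Notation plane := (RM * RM)%type.
Implicit Types (alpha : {posnum R}) (f g : R[i] -> R[i]) (z w : R[i]).

(** The [p]-th power of the modulus of the exponential factor is the translation weight up to the
    constant [e^(alpha |z|^2)]. The factor is holomorphic in [u] and equals 1 at 0, so [h] stays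
    entire with [h 0 = f z]. *)
Lemma fock_norm_weighted_translation alpha (p : R) f z (h := fun u => f (z + u) *
    cexp (- (2 * alpha%:num / p)%:C * conjc z * u)) : 1 < p -> entire f ->
  fock_norm alpha p h =
  ((expR (alpha%:num / p * normc z ^+ 2))%:E * fock_norm alpha p f)%E.
Proof.
move=> p1 ef; have p0 : 0 < p by lra.
have pn0 : p != 0 by rewrite gt_eqF.
have mfp : measurable_fun [set: plane] (fun x => (normc (f (toC x)) `^ p)%:E).
  apply/measurable_EFinP.
  apply: (@measurableT_comp _ _ _ _ _ _ (@powR R ^~ p)); first exact: measurable_powR.
  by apply: cmeasurable_normc; exact: entire_measurable.
have hE u : normc (h u) `^ p =
    expR (alpha%:num * normc z ^+ 2) * (normc (f (z + u)) `^ p *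
    expR (- (2 * alpha%:num * dotC z u) - alpha%:num * normc z ^+ 2)).
  rewrite /h normcM powRM ?normc_ge0// normc_cexp -expRM mulrCA -expRD.
  congr (_ * expR _).
  have -> : complex.Re (- (2 * alpha%:num / p)%:C * conjc z * u) =
      - (2 * alpha%:num / p) * dotC z u.
    by case: z @h => a b h; case: u => c d; rewrite /dotC /=; ring.
  by rewrite mulrAC mulNr divfK//; ring.
have E : (fock_norm alpha p h `^ p =
    (expR (alpha%:num * normc z ^+ 2))%:E * fock_norm alpha p f `^ p)%E.
  rewrite !poweR_fock_norm//.
  rewrite (@fock_translationC R alpha z (fun w => (normc (f w) `^ p)%:E))//; last first.
    by move=> w; rewrite lee_fin powR_ge0.
  rewrite -ge0_integralZl//=; last 2 first.
  - apply: emeasurable_funM.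
      apply/measurable_EFinP.
      apply: (@measurableT_comp _ _ _ _ _ _ (@powR R ^~ p)); first exact: measurable_powR.
      apply: cmeasurable_normc.
      exact: (entire_measurable (entire_comp ef (entireD (@entire_cst R z) (@entire_id R)))).
    apply/measurable_EFinP.
    have := measurable_translation_weight alpha (ofC z).
    by rewrite (_ : translation_weight _ _ = fun x => expR
      (- (2 * alpha%:num * dotC z (toC x)) - alpha%:num * normc z ^+ 2))//;
      apply/funext => x; rewrite translation_weightE.
  - by move=> x _; rewrite mule_ge0// lee_fin ?powR_ge0 ?expR_ge0.
  by apply: eq_integral => x _; rewrite hE !EFinM.
have N0 g : (0 <= fock_norm alpha p g)%E by exact: Lnorm_ge0.
have rootE (x : \bar R) : (0 <= x)%E -> ((x `^ p) `^ p^-1 = x)%E.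
  by move=> x0; rewrite -poweRrM divff// poweRe1.
rewrite -[LHS]rootE// E poweRM ?poweR_ge0 ?lee_fin ?expR_ge0// rootE//.
by rewrite poweR_EFin -expRM mulrAC.
Qed.

(** Hölder against the constant 1, whose norm is 1 for a probability measure. *)
Lemma integral_normc_le_fock_norm alpha (p : R) f : 1 < p -> entire f ->
  (\int[fock_measure alpha]_x (normc (f (toC x)))%:E <= fock_norm alpha p f)%E.
Proof.
move=> p1 ef; have p0 : 0 < p by lra.
pose q := p / (p - 1).
have q0 : 0 < q by rewrite divr_gt0// subr_gt0.
have pq : p^-1 + q^-1 = 1.
  by rewrite /q; field; rewrite !gt_eqF// ?subr_gt0.
have mf : measurable_fun [set: plane] (fun x => normc (f (toC x))).
  by apply: cmeasurable_normc; exact: entire_measurable.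
have := @hoelder _ _ R (fock_measure alpha) (fun x => normc (f (toC x))) (cst 1)
  p q mf (measurable_cst _) p0 q0 pq.
rewrite Lnorm1.
have -> : ('N[fock_measure alpha]_q%:E[EFin \o cst 1%R] = 1)%E.
  apply: (etrans (Lnorm_cst1 (fock_measure alpha) q)).
  by rewrite [X in (X `^ _)%E]fock_measure_setT poweR1r.
rewrite mule1; apply: le_trans.
rewrite le_eqVlt; apply/orP; left; apply/eqP.
by apply: eq_integral => x _ /=; rewrite mulr1 ger0_norm ?normc_ge0.
Qed.

(** The mean value formula at 0, applied to the weighted translate [h] of [f]; the 2 is that of
    [normc_cintegral]. *)
Lemma fock_pointwise alpha (p : R) f z : 1 < p -> entire f ->
  ((normc (f z))%:E <= 2%:E *
    ((expR (alpha%:num / p * normc z ^+ 2))%:E * fock_norm alpha p f))%E.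
Proof.
move=> p1 ef; rewrite -fock_norm_weighted_translation//.
set h := fun u => _.
have eh : entire h.
  apply: entireM.
    exact: (entire_comp ef (entireD (@entire_cst R z) (@entire_id R))).
  exact: (entire_comp (@entire_cexp R) (entireM (@entire_cst R _) (@entire_id R))).
have hf : h 0 = f z by rewrite /h addr0 mulr0 cexp0 mulr1.
apply: (@le_trans _ _ (2%:E * \int[fock_measure alpha]_x (normc (h (toC x)))%:E)%E);
  last by rewrite lee_wpmul2l//; exact: integral_normc_le_fock_norm.
(* An infinite integral makes the bound trivial; a finite one is the hypothesis of [fock_mean]. *)
have [hoo|] := ltP (\int[fock_measure alpha]_x (normc (h (toC x)))%:E)%E +oo%E; last first.
  by rewrite leye_eq => /eqP ->; rewrite gt0_muley ?leey// lte_fin.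
have ih : cintegrable (fock_measure alpha) (fun x => h (toC x)).
  by split=> //; exact: entire_measurable.
have := normc_cintegral ih; rewrite fock_mean//.
by rewrite hf.
Qed.

Lemma gaussian_cintegrable alpha (F : plane -> R[i]) (A b : R) : cmeasurable F ->
  b < alpha%:num ->
  (forall x, normc (F x) <= A * expR (b * normc (toC x) ^+ 2)) ->
  cintegrable (fock_measure alpha) F /\
  normc (cintegral (fock_measure alpha) F) <= 2 * (A * (alpha%:num / (alpha%:num - b))).
Proof.
move=> mF ba FA.
have A0 : 0 <= A.
  have := le_trans (normc_ge0 _) (FA (0, 0)).
  by rewrite pmulr_lge0// expR_gt0.
have mG : measurable_fun [set: plane] (fun x => A * expR (b * normc (toC x) ^+ 2)).
  by apply: measurable_funM => //; exact: measurable_gaussian.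
have GE : (\int[fock_measure alpha]_x (A * expR (b * normc (toC x) ^+ 2))%:E =
    (A * (alpha%:num / (alpha%:num - b)))%:E)%E.
  under eq_integral do rewrite EFinM.
  rewrite ge0_integralZl ?lee_fin//; last first.
    by apply/measurable_EFinP; exact: measurable_gaussian.
  by rewrite fock_gaussian.
have iF : cintegrable (fock_measure alpha) F.
  by apply: (cintegrable_dominated mF mG FA); rewrite GE ltry.
split=> //; rewrite -lee_fin; apply: (le_trans (normc_cintegral iF)).
rewrite EFinM lee_wpmul2l// -GE; apply: ge0_le_integral => //=.
- by move=> x _; rewrite lee_fin normc_ge0.
- by apply/measurable_EFinP; exact: cmeasurable_normc.
- exact/measurable_EFinP.
- by move=> x _; rewrite lee_fin.
Qed.

Lemma conjc_fock_kernel alpha z w :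
  conjc (fock_kernel alpha z w) = cexp (alpha%:num%:C * conjc w * z).
Proof.
rewrite /fock_kernel conjc_cexp; congr cexp.
by case: z => a b; case: w => c d; apply/eqP; rewrite eq_complex /=;
  apply/andP; split; apply/eqP; ring.
Qed.

End FockEstimates.

(** * Second-order Taylor bounds uniform in the function *)

Section FockTaylor.
Context {R : realType}.
Local Notation plane := (measurableTypeR R * measurableTypeR R)%type.
Implicit Types (f g : R[i] -> R[i]) (z w : R[i]).

Lemma dotC_le_normc z w : dotC z w <= normc z * normc w.
Proof.
rewrite -[normc w]normcJ -normcM; apply: le_trans (le_normc_Re _).
apply: le_trans (ler_norm _); rewrite /dotC.
by case: z => a b; case: w => c d /=; lra.
Qed.

(** The Gaussian growth makes [g] an element of a Fock space of larger parameter;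
    the bound is read off its reproducing formula there. *)
Lemma entire_taylor_bound (c : R) z : 0 <= c ->
  exists2 K, 0 <= K & forall g M, entire g ->
    (forall u, normc (g u) <= M * expR (c * normc u ^+ 2)) ->
    exists d, forall t, normc t <= 1 ->
      normc (g (z + t) - g z - d * t) <= K * M * normc t ^+ 2.
Proof.
move=> c0; have b0 : 0 < 2 * c + 1 by lra.
pose beta := PosNum b0; set b := 2 * c + 1 in b0 beta.
(* With [r = |x|], the kernel contributes [e^(b |z| r)] and the Taylor remainder at most
   [e^(3 b r)], together [e^(s r)]. Since [s r <= s^2 / 2 + r^2 / 2], this costs a constant and
   raises the exponent from [c] to [c + 1/2], still below [b]. The 4 in [A] comes from
   [cexp_taylor]. *)
pose s := b * (normc z + 3).
pose A := 4 * expR (s ^+ 2 / 2).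
pose I := b / (b - (c + 2^-1)).
have cb : c + 2^-1 < beta%:num by rewrite /= /b; lra.
have I0 : 0 <= I by rewrite divr_ge0 ?ltW// subr_gt0.
have A0 : 0 <= A by rewrite mulr_ge0// expR_ge0.
exists (2 * (A * I)); first exact: (mulr_ge0 (ler0n _ 2) (mulr_ge0 A0 I0)).
move=> g M eg gM.
have fg : fock beta g.
  by apply: (@fock_of_gaussian_bound R beta g M c eg _ gM) => /=; rewrite /b; lra.
have mg := entire_measurable eg.
pose G w (x : plane) := g (toC x) * conjc (fock_kernel beta w (toC x)).
have GI w : cintegral (fock_measure beta) (G w) = g w := fock_reproducing w fg.
have iG w : cintegrable (fock_measure beta) (G w).
  exact: (fock_cintegrable fg (fock_fock_kernel beta w)).
(* The derivative in [z] of the integrand [G z x], as [conj (K_z x) = e^(b (conj x) z)]. *)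
pose D (x : plane) := b%:C * (conjc (toC x) * G z x).
have mD : cmeasurable D.
  apply: cmeasurableM; first exact: cmeasurable_cst.
  apply: cmeasurableM; last exact: (iG z).1.
  exact: (cmeasurable_conj (entire_measurable (@entire_id R))).
have GN x : normc (G z x) <= M * expR (c * normc (toC x) ^+ 2) *
    expR (b * (normc z * normc (toC x))).
  rewrite /G normcM normcJ normc_fock_kernel; apply: ler_pM => //.
    exact: normc_ge0.
  rewrite ler_expR ler_pM2l// [leRHS]mulrC; exact: dotC_le_normc.
have M0 : 0 <= M.
  by have := le_trans (normc_ge0 _) (gM 0); rewrite pmulr_lge0// expR_gt0.
have key (r : R) : 0 <= r -> expR (c * r ^+ 2) * expR (b * (normc z * r)) *
    expR (b * r) ^+ 3 <= expR (s ^+ 2 / 2) * expR ((c + 2^-1) * r ^+ 2).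
  move=> r0; rewrite -expRM_natl -!expRD ler_expR.
  have := sqr_ge0 (s - r); rewrite /s; nra.
have expge (r : R) : 0 <= r -> 1 <= expR (b * r).
  by move=> r0; rewrite -expR0 ler_expR mulr_ge0// ltW.
have mulge (r : R) : 0 <= r -> b * r <= expR (b * r).
  by move=> r0; have := expR_ge1Dx (b * r); lra.
have DN x : normc (D x) <= (M * expR (s ^+ 2 / 2)) *
    expR ((c + 2^-1) * normc (toC x) ^+ 2).
  rewrite /D normcM normc_real normcM normcJ gtr0_norm//.
  have := GN x; have := normc_ge0 (toC x); have := normc_ge0 (G z x).
  move: (normc (toC x)) (normc (G z x)) => r Gr Gr0 r0 H.
  rewrite mulrA.
  (* One factor [expR (b * r)] would do; the cube lets [key] serve both here and for the
     remainder. *)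
  apply: (@le_trans _ _ (expR (b * r) ^+ 3 * (M * expR (c * r ^+ 2) *
    expR (b * (normc z * r))))).
    have br0 : 0 <= b * r by rewrite mulr_ge0// ltW.
    have h1 : b * r <= expR (b * r) ^+ 3.
      by apply: le_trans (mulge r r0) _; rewrite -[leLHS]expr1 ler_weXn2l// expge.
    exact: (ler_pM br0 Gr0 h1 H).
  by have := ler_wpM2l M0 (key r r0); lra.
have [iD _] := gaussian_cintegrable mD cb DN.
exists (cintegral (fock_measure beta) D) => t t1.
(* The Taylor remainder of the integrand. For [|t| <= 1], its quadratic factor costs two powers of
   [expR (b * r)] and its exponential factor the third. *)
pose E (x : plane) := G z x * (cexp (b%:C * conjc (toC x) * t) - 1 - b%:C * conjc (toC x) * t).
have EE x : E x = G (z + t) x + ((-1) * G z x + (- t) * D x).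
  have -> : G (z + t) x = G z x * cexp (b%:C * conjc (toC x) * t).
    rewrite /G !conjc_fock_kernel -[RHS]mulrA -cexpD; congr (_ * cexp _).
    by rewrite mulrDr.
  by rewrite /E /D; ring.
have -> : g (z + t) - g z - cintegral (fock_measure beta) D * t =
    cintegral (fock_measure beta) E.
  transitivity (cintegral (fock_measure beta)
      (fun x => G (z + t) x + ((-1) * G z x + (- t) * D x))); last first.
    by congr cintegral; apply/funext => x; rewrite EE.
  have i1 := cintegrableZ (-1) (iG z); have i2 := cintegrableZ (- t) iD.
  rewrite (cintegralD (iG _) (cintegrableD i1 i2)) (cintegralD i1 i2).
  by rewrite (cintegralZ _ (iG z)) (cintegralZ _ iD) !GI; ring.
have mE : cmeasurable E.
  rewrite (_ : E = fun x => G (z + t) x + ((-1) * G z x + (- t) * D x)); last first.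
    by apply/funext => x; rewrite EE.
  apply: cmeasurableD; first exact: (iG _).1.
  apply: cmeasurableD; first exact: (cintegrableZ (-1) (iG z)).1.
  exact: (cintegrableZ (- t) iD).1.
have EN x : normc (E x) <= (A * M * normc t ^+ 2) *
    expR ((c + 2^-1) * normc (toC x) ^+ 2).
  have Nq : normc (b%:C * conjc (toC x) * t) = b * normc (toC x) * normc t.
    by rewrite !normcM normc_real normcJ gtr0_norm.
  have := cexp_taylor (b%:C * conjc (toC x) * t); rewrite Nq /E normcM.
  have := GN x; have := normc_ge0 (toC x); have := normc_ge0 (G z x).
  have := normc_ge0 (cexp (b%:C * conjc (toC x) * t) - 1 - b%:C * conjc (toC x) * t).
  move: (normc (cexp _ - _ - _)) => N.
  move: (normc (toC x)) (normc (G z x)) => r Gr N0 Gr0 r0 H H2.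
  have tt0 := normc_ge0 t.
  have br0 : 0 <= b * r by rewrite mulr_ge0// ltW.
  apply: (le_trans (ler_pM Gr0 N0 H H2)).
  have h1 : (b * r * normc t) ^+ 2 <= expR (b * r) ^+ 2 * normc t ^+ 2.
    rewrite exprMn ler_wpM2r ?sqr_ge0// lerXn2r ?nnegrE ?expR_ge0//.
    exact: mulge.
  have h2 : expR (b * r * normc t) <= expR (b * r).
    by rewrite ler_expR ler_piMr.
  apply: (@le_trans _ _ (M * expR (c * r ^+ 2) * expR (b * (normc z * r)) *
    (4 * (expR (b * r) ^+ 2 * normc t ^+ 2) * expR (b * r)))).
    apply: ler_wpM2l; first exact: le_trans H.
    apply: (ler_pM _ (expR_ge0 _) _ h2); first by rewrite mulr_ge0// sqr_ge0.
    by rewrite ler_wpM2l.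
  have Mt : 0 <= 4 * M * normc t ^+ 2 by rewrite !mulr_ge0// sqr_ge0.
  by have := ler_wpM2l Mt (key r r0); rewrite /A; lra.
have [_] := gaussian_cintegrable mE cb EN; move=> /le_trans; apply.
by rewrite /I /=; lra.
Qed.

End FockTaylor.

(** * Schur's test and the extension of the operator *)

Section CauchySchwarz.
Context d (T : measurableType d) {R : realType} (m : {measure set T -> \bar R}).

(** Hölder with both exponents 2, squared. The real lower bound [c] stands in for the integral of
    [|u v|], which may be infinite. *)
Lemma integral_cauchy_schwarz (u v : T -> R) (c : R) :
  measurable_fun [set: T] u -> measurable_fun [set: T] v -> 0 <= c ->
  (c%:E <= \int[m]_x `|u x * v x|%:E)%E ->
  ((c ^+ 2)%:E <= (\int[m]_x (u x ^+ 2)%:E) * (\int[m]_x (v x ^+ 2)%:E))%E.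
Proof.
move=> mu mv c0 cuv.
have two0 : 0 < 2 :> R by [].
have half : 2^-1 + 2^-1 = 1 :> R by field.
have H := hoelder m mu mv two0 two0 half.
have N2 (w : T -> R) : ('N[m]_(2%:E)[EFin \o w] `^ 2 = \int[m]_x (w x ^+ 2)%:E)%E.
  rewrite poweR_Lnorm ?pnatr_eq0//; apply: eq_integral => x _ /=.
  by rewrite powR_mulrn// real_normK// num_real.
rewrite -!N2 -poweRM ?Lnorm_ge0//.
have -> : (c ^+ 2)%:E = (c%:E `^ 2)%E by rewrite poweR_EFin powR_mulrn.
apply: gt0_ler_poweR => //; rewrite ?in_itv/= ?andbT ?leey ?lee_fin ?mule_ge0 ?Lnorm_ge0//.
  by rewrite c0.
by apply: le_trans H; rewrite Lnorm1.
Qed.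

End CauchySchwarz.

Section Schur.
Context {R : realType}.
Local Notation RM := (measurableTypeR R).
Local Notation plane := (RM * RM)%type.
Implicit Types (f g F : R[i] -> R[i]) (z w : R[i]).
Variables (alpha : {posnum R}) (a : R).
Hypothesis a_lt : a < alpha%:num / 2.

(** Exponent of the kernel bound. Subtracting [alpha / 2] times [|z|^2] and [|w|^2] leaves
    [- (alpha / 2 - a) |z - w|^2]. *)
Definition schur_exp z w := alpha%:num * dotC z w + a * normc (z - w) ^+ 2.

Lemma schur_expC z w : schur_exp z w = schur_exp w z.
Proof.
rewrite /schur_exp !sqr_normc !ReB !ImB /dotC.
ring.
Qed.

Let half_alpha := alpha%:num / 2.
Let mass := alpha%:num / (half_alpha - a).

Lemma measurable_schur_exp : measurable_fun [set: plane * plane]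
  (fun p : plane * plane => schur_exp (toC p.1) (toC p.2)).
Proof.
have m11 : measurable_fun [set: plane * plane] (fun p : plane * plane => p.1.1).
  by apply: (measurableT_comp measurable_fst); exact: measurable_fst.
have m12 : measurable_fun [set: plane * plane] (fun p : plane * plane => p.1.2).
  by apply: (measurableT_comp measurable_snd); exact: measurable_fst.
have m21 : measurable_fun [set: plane * plane] (fun p : plane * plane => p.2.1).
  by apply: (measurableT_comp measurable_fst); exact: measurable_snd.
have m22 : measurable_fun [set: plane * plane] (fun p : plane * plane => p.2.2).
  by apply: (measurableT_comp measurable_snd); exact: measurable_snd.
rewrite (_ : (fun p => _) = fun p : plane * plane =>
  alpha%:num * (p.1.1 * p.2.1 + p.1.2 * p.2.2) +
  a * ((p.1.1 - p.2.1) ^+ 2 + (p.1.2 - p.2.2) ^+ 2)); last first.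
  by apply/funext => p; rewrite /schur_exp sqr_normc.
apply: measurable_funD; apply: measurable_funM => //; apply: measurable_funD.
- exact: measurable_funM.
- exact: measurable_funM.
- by apply: measurable_funX; exact: measurable_funB.
- by apply: measurable_funX; exact: measurable_funB.
Qed.

Lemma measurable_sqr_normc_toC :
  measurable_fun [set: plane] (fun x : plane => normc (toC x) ^+ 2).
Proof.
under eq_fun do rewrite sqr_normc_toC.
by apply: measurable_funD; apply: measurable_funX.
Qed.

Lemma measurable_schur_weight (b c : R) : measurable_fun [set: plane * plane]
  (fun p : plane * plane => expR (schur_exp (toC p.1) (toC p.2) +
     b * normc (toC p.1) ^+ 2 + c * normc (toC p.2) ^+ 2)).
Proof.
apply: measurableT_comp => //.
apply: measurable_funD; first apply: measurable_funD.
- exact: measurable_schur_exp.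
- apply: measurable_funM => //.
  exact: (measurableT_comp measurable_sqr_normc_toC).
- apply: measurable_funM => //.
  exact: (measurableT_comp measurable_sqr_normc_toC).
Qed.

(** After the translation [w = z + x] the mixed terms cancel and the exponent is [(alpha / 2) |z|^2
    + (a + alpha / 2) |x|^2]; the second term is integrable because [a < alpha / 2]. *)
Lemma schur_test z :
  (\int[fock_measure alpha]_x
     (expR (schur_exp z (toC x) + half_alpha * normc (toC x) ^+ 2))%:E =
   (mass * expR (half_alpha * normc z ^+ 2))%:E)%E.
Proof.
have mh : measurable_fun [set: plane]
    ((fun w => (expR (schur_exp z w + half_alpha * normc w ^+ 2))%:E) \o toC).
  apply/measurable_EFinP.
  have := measurableT_comp (measurable_schur_weight 0 half_alpha)
    (pair1_measurable (ofC z)).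
  congr measurable_fun; apply/funext => x /=.
  by rewrite ofCK mul0r addr0.
rewrite (fock_translationC alpha z mh); last by move=> w; rewrite lee_fin expR_ge0.
have ah : a + half_alpha < alpha%:num by rewrite /half_alpha; move: a_lt; lra.
transitivity (\int[fock_measure alpha]_x ((expR (half_alpha * normc z ^+ 2))%:E *
    (expR ((a + half_alpha) * normc (toC x) ^+ 2))%:E))%E.
  apply: eq_integral => x _; rewrite -!EFinM -!expRD; congr (expR _)%:E.
  rewrite /schur_exp /half_alpha /dotC !sqr_normc !ReB !ImB !ReD !ImD.
  by field.
rewrite ge0_integralZl ?lee_fin ?expR_ge0//; last first.
  by apply/measurable_EFinP; exact: measurable_gaussian.
rewrite fock_gaussian// -EFinM; congr EFin; rewrite mulrC /mass; congr (_ / _ * _).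
by rewrite /half_alpha; field.
Qed.

(** Schur's test, with test function [e^(alpha |w|^2 / 2)] on both sides. *)
Lemma schur_bound f F (M : R) : entire f -> entire F -> 0 <= M ->
  (forall z, ((normc (F z))%:E <= M%:E * \int[fock_measure alpha]_x
     (normc (f (toC x)) * expR (schur_exp z (toC x)))%:E)%E) ->
  (sqnorm alpha F <= ((M * mass) ^+ 2)%:E * sqnorm alpha f)%E.
Proof.
move=> ef eF M0 HF.
have mass0 : 0 <= mass.
  by rewrite /mass divr_ge0// subr_ge0 ltW.
have mf : measurable_fun [set: plane] (fun x => normc (f (toC x))).
  by apply: cmeasurable_normc; exact: entire_measurable.
(* In the Cauchy-Schwarz step [k] is the square of the factor that carries [f]; the other factor has
   the opposite weight, and its square is integrated by [schur_test]. *)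
pose k z x := normc (f (toC x)) ^+ 2 *
  expR (schur_exp z (toC x) - half_alpha * normc (toC x) ^+ 2).
have mk2 : measurable_fun [set: plane * plane] (fun p : plane * plane =>
    (normc (f (toC p.2)) ^+ 2 * expR (schur_exp (toC p.1) (toC p.2) +
     half_alpha * normc (toC p.1) ^+ 2 + (- half_alpha) * normc (toC p.2) ^+ 2))%:E).
  apply/measurable_EFinP; apply: measurable_funM; last exact: measurable_schur_weight.
  by apply: measurable_funX; exact: (measurableT_comp mf).
have k0 (p : plane * plane) : (0 <= (normc (f (toC p.2)) ^+ 2 *
    expR (schur_exp (toC p.1) (toC p.2) +
     half_alpha * normc (toC p.1) ^+ 2 + (- half_alpha) * normc (toC p.2) ^+ 2))%:E)%E.
  by rewrite lee_fin mulr_ge0 ?sqr_ge0 ?expR_ge0.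
have mk z : measurable_fun [set: plane] (k z).
  apply: measurable_funM; first exact: measurable_sqnormc.
  have := measurableT_comp (measurable_schur_weight 0 (- half_alpha))
    (pair1_measurable (ofC z)).
  congr measurable_fun; apply/funext => x /=.
  by rewrite ofCK mul0r addr0 mulNr.
have pw z : ((normc (F z) ^+ 2)%:E <= (M ^+ 2 * mass)%:E *
    \int[fock_measure alpha]_x (expR (half_alpha * normc z ^+ 2) * k z x)%:E)%E.
  have mE (b : R) : measurable_fun [set: plane] (fun x =>
      expR ((schur_exp z (toC x) + b * normc (toC x) ^+ 2) / 2)).
    apply: measurableT_comp => //; apply: measurable_funM => //.
    apply: measurable_funD; last first.
      by apply: measurable_funM => //; exact: measurable_sqr_normc_toC.
    have := measurableT_comp measurable_schur_exp (pair1_measurable (ofC z)).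
    by congr measurable_fun; apply/funext => x /=; rewrite ofCK.
  pose u (x : plane) := normc (f (toC x)) *
    expR ((schur_exp z (toC x) + (- half_alpha) * normc (toC x) ^+ 2) / 2).
  pose v (x : plane) := expR ((schur_exp z (toC x) + half_alpha * normc (toC x) ^+ 2) / 2).
  have uv x : `|u x * v x| = normc (f (toC x)) * expR (schur_exp z (toC x)).
    rewrite /u /v -mulrA -expRD ger0_norm ?mulr_ge0 ?normc_ge0 ?expR_ge0//.
    by congr (_ * expR _); field.
  have u2 x : u x ^+ 2 = k z x.
    rewrite /u /k exprMn; congr (_ * _); rewrite -expRM_natl; congr expR.
    by field.
  have v2 x : v x ^+ 2 = expR (schur_exp z (toC x) + half_alpha * normc (toC x) ^+ 2).
    by rewrite /v -expRM_natl; congr expR; field.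
  have FJ := HF z.
  (* The bound is divided by [M] below; when [M] is 0, [F z] vanishes. *)
  have [M00|Mgt0] := eqVneq M 0.
    move: FJ; rewrite M00 mul0e lee_fin => F0.
    have -> : normc (F z) = 0 by apply/le_anti; rewrite F0 normc_ge0.
    by rewrite !expr0n !mul0r mul0e.
  have Mp : 0 < M by rewrite lt0r Mgt0.
  have cle : ((normc (F z) / M)%:E <=
      \int[fock_measure alpha]_x `|u x * v x|%:E)%E.
    under eq_integral do rewrite uv.
    by rewrite EFinM muleC lee_pdivrMl.
  have c0 : 0 <= normc (F z) / M by rewrite divr_ge0 ?normc_ge0.
  have mu_ : measurable_fun [set: plane] u by exact: measurable_funM.
  have := integral_cauchy_schwarz mu_ (mE half_alpha) c0 cle.
  have -> : (\int[fock_measure alpha]_x (u x ^+ 2)%:E =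
      \int[fock_measure alpha]_x (k z x)%:E)%E.
    by apply: eq_integral => x _; rewrite u2.
  have -> : (\int[fock_measure alpha]_x (v x ^+ 2)%:E =
      (mass * expR (half_alpha * normc z ^+ 2))%:E)%E.
    by rewrite -schur_test; apply: eq_integral => x _; rewrite v2.
  have -> : (\int[fock_measure alpha]_x (expR (half_alpha * normc z ^+ 2) * k z x)%:E =
      (expR (half_alpha * normc z ^+ 2))%:E * \int[fock_measure alpha]_x (k z x)%:E)%E.
    under eq_integral do rewrite EFinM.
    rewrite ge0_integralZl ?lee_fin ?expR_ge0//; first exact/measurable_EFinP.
    by move=> x _; rewrite lee_fin mulr_ge0 ?sqr_ge0 ?expR_ge0.
  have -> : (((normc (F z) / M) ^+ 2)%:E =
      (M ^+ 2)^-1%:E * (normc (F z) ^+ 2)%:E)%E.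
    by rewrite -EFinM expr_div_n mulrC.
  rewrite lee_pdivrMl ?exprn_gt0// => /le_trans; apply.
  rewrite le_eqVlt; apply/orP; left; apply/eqP.
  rewrite [in RHS]muleA -EFinM [X in (_ * X)%E = _]muleC muleA -EFinM.
  by congr (_%:E * _)%E; ring.
pose Phi (p : plane * plane) := (normc (f (toC p.2)) ^+ 2 *
  expR (schur_exp (toC p.1) (toC p.2) +
     half_alpha * normc (toC p.1) ^+ 2 + (- half_alpha) * normc (toC p.2) ^+ 2))%:E.
have PhiE x y : Phi (x, y) = (expR (half_alpha * normc (toC x) ^+ 2) * k (toC x) y)%:E.
  rewrite /Phi /k /= [in RHS]mulrCA -expRD; congr (_ * expR _)%:E; ring.
apply: (@le_trans _ _ (\int[fock_measure alpha]_x ((M ^+ 2 * mass)%:E *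
    \int[fock_measure alpha]_y Phi (x, y)))%E).
  apply: ge0_le_integral => //=.
  - by move=> x _; rewrite lee_fin sqr_ge0.
  - by apply/measurable_EFinP; exact: measurable_sqnormc.
  - apply: emeasurable_funM; first exact: measurable_cst.
    exact: measurable_fun_fubini_tonelli_F.
  - move=> x _; apply: (le_trans (pw (toC x))).
    by under eq_integral do rewrite -PhiE.
have M2 : (0 <= (M ^+ 2 * mass)%:E)%E by rewrite lee_fin (mulr_ge0 (sqr_ge0 M) mass0).
rewrite ge0_integralZl//; last 2 first.
- exact: measurable_fun_fubini_tonelli_F.
- by move=> x _; apply: integral_ge0 => y _; exact: k0.
rewrite (fubini_tonelli Phi mk2 k0).
(* After Tonelli the remaining integral is [schur_test] again, by symmetry of the exponent; its
   factor [e^(alpha |y|^2 / 2)] cancels the weight left by Cauchy-Schwarz. *)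
have inner y : (\int[fock_measure alpha]_x Phi (x, y) =
    mass%:E * (normc (f (toC y)) ^+ 2)%:E)%E.
  rewrite (eq_integral (fun x => ((normc (f (toC y)) ^+ 2 *
    expR (- half_alpha * normc (toC y) ^+ 2))%:E *
    (expR (schur_exp (toC y) (toC x) + half_alpha * normc (toC x) ^+ 2))%:E)%E)); last first.
    move=> x _; rewrite /Phi -EFinM; congr EFin.
    rewrite -[RHS]mulrA -expRD schur_expC /=.
    by congr (_ * expR _); ring.
  have cc : (0 <= (normc (f (toC y)) ^+ 2 *
      expR (- half_alpha * normc (toC y) ^+ 2))%:E)%E.
    by rewrite lee_fin (mulr_ge0 (sqr_ge0 _) (expR_ge0 _)).
  rewrite ge0_integralZl//; last first.
    apply/measurable_EFinP.
    have := measurableT_comp (measurable_schur_weight 0 half_alpha) (pair1_measurable y).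
    by congr measurable_fun; apply/funext => x /=; rewrite mul0r addr0.
  rewrite schur_test -!EFinM; congr EFin.
  have e1 : expR (- half_alpha * normc (toC y) ^+ 2) *
      expR (half_alpha * normc (toC y) ^+ 2) = 1.
    by rewrite -expRD mulNr addNr expR0.
  by rewrite mulrACA e1 mulr1 mulrC.
rewrite (eq_integral _ _ (fun y _ => inner y)).
have massE0 : (0 <= mass%:E)%E by rewrite lee_fin.
rewrite ge0_integralZl//; last 2 first.
- by apply/measurable_EFinP; exact: measurable_sqnormc.
- by move=> x _; rewrite lee_fin sqr_ge0.
rewrite muleA -EFinM le_eqVlt; apply/orP; left; apply/eqP.
by congr (_%:E * _)%E; ring.
Qed.

End Schur.

(** * Linear structure of the Fock space and the bound on the kernel of [S] *)

Section FockOperator.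
Context {R : realType}.
Local Notation plane := (measurableTypeR R * measurableTypeR R)%type.
Implicit Types (f g : R[i] -> R[i]) (z w : R[i]).
Variable alpha : {posnum R}.

Lemma fock_linear (c : R[i]) f g : fock alpha f -> fock alpha g ->
  fock alpha (fun z => c * f z + g z).
Proof.
move=> /fockP[ef of_] /fockP[eg og]; apply/fockP; split.
  exact: (entireD (entireM (@entire_cst R c) ef) eg).
have mE u : entire u -> measurable_fun [set: plane] (fun x => (normc (u (toC x)) ^+ 2)%:E).
  by move=> eu; apply/measurable_EFinP; exact: measurable_sqnormc.
(* From [(x + y)^2 <= 2 x^2 + 2 y^2]. *)
apply: (@le_lt_trans _ _ ((2 * normc c ^+ 2)%:E * sqnorm alpha f + 2%:E * sqnorm alpha g)%E).
  have IZ (k : R) u : 0 <= k -> entire u -> (k%:E * sqnorm alpha u =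
      \int[fock_measure alpha]_x (k * normc (u (toC x)) ^+ 2)%:E)%E.
    move=> k0 eu; under [RHS]eq_integral do rewrite EFinM.
    rewrite ge0_integralZl//; first exact: mE.
    by move=> x _; rewrite lee_fin sqr_ge0.
  have c2 : 0 <= 2 * normc c ^+ 2 by rewrite mulr_ge0// sqr_ge0.
  have mkE (k : R) u : entire u ->
      measurable_fun [set: plane] (fun x => (k * normc (u (toC x)) ^+ 2)%:E).
    move=> eu; apply/measurable_EFinP; apply: measurable_funM => //.
    exact: measurable_sqnormc.
  rewrite !IZ// -ge0_integralD//=; last 4 first.
  - by move=> x _; rewrite lee_fin mulr_ge0 ?sqr_ge0.
  - exact: mkE.
  - by move=> x _; rewrite lee_fin mulr_ge0 ?sqr_ge0.
  - exact: mkE.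
  apply: ge0_le_integral => //=.
  - by move=> x _; rewrite lee_fin sqr_ge0.
  - exact: (mE _ (entireD (entireM (@entire_cst R c) ef) eg)).
  - by apply: emeasurable_funD; exact: mkE.
  move=> x _; rewrite -EFinD lee_fin.
  have := le_normcD (c * f (toC x)) (g (toC x)); rewrite normcM.
  have := normc_ge0 (c * f (toC x) + g (toC x)).
  move: (normc _) (normc c) (normc (f _)) (normc (g _)) => s k u v s0 h.
  apply: (@le_trans _ _ ((k * u + v) ^+ 2)).
    by rewrite lerXn2r ?nnegrE//; exact: le_trans h.
  by have := sqr_ge0 (k * u - v); nra.
apply: lte_add_pinfty; apply: lte_mul_pinfty => //.
by rewrite lee_fin mulr_ge0 ?sqr_ge0.
Qed.

Lemma fock0 : fock alpha (fun=> 0).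
Proof.
apply: (@fock_of_gaussian_bound _ _ _ 0 0); first exact: entire_cst.
  by rewrite mulr0.
by move=> z; rewrite normc0 mul0r.
Qed.

Lemma cintegral_conj (F : plane -> R[i]) : cintegrable (fock_measure alpha) F ->
  cintegral (fock_measure alpha) (fun x => conjc (F x)) =
  conjc (cintegral (fock_measure alpha) F).
Proof.
move=> iF; rewrite /cintegral /=; congr (_ +i* _).
  by apply: eq_Rintegral => x _; case: (F x).
rewrite -mulN1r -RintegralZl//; last exact: cintegrable_Im.
by apply: eq_Rintegral => x _; case: (F x) => a b /=; rewrite mulN1r.
Qed.

Lemma fock_inner_conj f g : fock alpha f -> fock alpha g ->
  fock_inner alpha g f = conjc (fock_inner alpha f g).
Proof.
move=> ff fg; have H := cintegral_conj (fock_cintegrable ff fg).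
apply: etrans H; congr cintegral; apply/funext => x.
by rewrite rmorphM/= conjcK mulrC.
Qed.

(** [K(z, z)] is the square of a nonnegative real, so the complex square root in the definition is
    that real. *)
Lemma fock_nkernelE z w : fock_nkernel alpha z w =
  (expR (- (alpha%:num / 2 * normc z ^+ 2)))%:C * fock_kernel alpha z w.
Proof.
have zz : fock_kernel alpha z z = (expR (alpha%:num / 2 * normc z ^+ 2))%:C ^+ 2.
  rewrite -rmorphXn/= -expRM_natl -cexp_real; congr cexp.
  rewrite sqr_normc; case: z => a b; apply/eqP; rewrite eq_complex /=.
  by apply/andP; split; apply/eqP; field.
rewrite /fock_nkernel zz sqrCK ?lecR ?expR_ge0//.
by rewrite mulrC expRN -fmorphV.
Qed.

Section Kernel.
Variables (S : fock_operator alpha) (hS : standing_assumptions S).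
Variables (p C : R).
Hypothesis p2 : 2 < p.
Hypothesis Sp : forall z, (fock_norm alpha p (fock_conj S z (fun=> 1%R)) <= C%:E)%E.

Lemma kernel_dom w : dom S (fock_kernel alpha w).
Proof.
case: hS => sub _ _; apply: sub; exists [:: (1, w)].
by apply/funext => z; rewrite big_seq1 /= mul1r.
Qed.

Lemma kernel_adjoint_dom w : adjoint_dom S (fock_kernel alpha w).
Proof.
case: hS => _ sub _; apply: sub; exists [:: (1, w)].
by apply/funext => z; rewrite big_seq1 /= mul1r.
Qed.

Lemma op_fun0 : S (fun=> 0) = fun=> 0.
Proof.
have := op_linear (-1) (dom0 S) (dom0 S).
have -> : (fun z : R[i] => -1 * 0 + 0) = (fun=> 0 : R[i]).
  by apply/funext => z; rewrite mulr0 addr0.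
by move=> ->; apply/funext => z; rewrite mulN1r addNr.
Qed.

Lemma op_scale c f : dom S f -> S (fun z => c * f z) = fun z => c * S f z.
Proof.
move=> df; have := op_linear c df (dom0 S); rewrite op_fun0.
have -> : (fun z => c * f z + 0) = (fun z => c * f z).
  by apply/funext => z; rewrite addr0.
by move=> ->; apply/funext => z; rewrite addr0.
Qed.

Lemma op_kernel_bound w z : normc (S (fock_kernel alpha w) z) <=
  2 * C * expR (schur_exp alpha (alpha%:num / p) w z).
Proof.
have dw := kernel_dom w.
set c := (expR (- (alpha%:num / 2 * normc w ^+ 2)))%:C.
have FE : fock_conj S w (fun=> 1) = fun u =>
    c * S (fock_kernel alpha w) (w - u) * (c * fock_kernel alpha w u).
  rewrite /fock_conj; have -> : fock_U alpha w (fun=> 1) = fun u => c * fock_kernel alpha w u.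
    by apply/funext => u; rewrite /fock_U mul1r fock_nkernelE.
  by rewrite op_scale//; apply/funext => u; rewrite /fock_U fock_nkernelE.
have eSk : entire (S (fock_kernel alpha w)) by have [] := op_fock dw.
have eF : entire (fock_conj S w (fun=> 1)).
  rewrite FE.
  have e1 : entire (fun u => w - u).
    rewrite (_ : (fun u => w - u) = fun u => w + (-1) * u).
      exact: (entireD (@entire_cst R w) (entireM (@entire_cst R _) (@entire_id R))).
    by apply/funext => u; rewrite mulN1r.
  exact: (entireM (entireM (@entire_cst R c) (entire_comp eSk e1))
    (entireM (@entire_cst R c) (@entire_fock_kernel R alpha w))).
have p1 : 1 < p by apply: lt_trans p2; rewrite ltr1n.
(* [U_w] reflects the argument by [u |-> w - u], so evaluation at [w - z] exposes [S K_w] at [z]. *)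
have := fock_pointwise alpha (w - z) p1 eF.
have bd : (2%:E * ((expR (alpha%:num / p * normc (w - z) ^+ 2))%:E *
    fock_norm alpha p (fock_conj S w (fun=> 1%R))) <=
    (2 * (expR (alpha%:num / p * normc (w - z) ^+ 2) * C))%:E)%E.
  by rewrite !EFinM lee_wpmul2l// lee_wpmul2l ?lee_fin ?expR_ge0.
move=> /le_trans/(_ bd); rewrite lee_fin FE subKr.
have c0 : normc c = expR (- (alpha%:num / 2 * normc w ^+ 2)).
  by rewrite normc_real ger0_norm ?expR_ge0.
rewrite normcM normcM [normc (c * fock_kernel _ _ _)]normcM normc_fock_kernel c0.
set N := normc (S _ z).
(* The two normalizing factors cancel the [|w|^2] part of [|K_w (w - z)|]. *)
have -> : expR (- (alpha%:num / 2 * normc w ^+ 2)) * N *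
   (expR (- (alpha%:num / 2 * normc w ^+ 2)) * expR (alpha%:num * dotC (w - z) w)) =
   N * expR (- (alpha%:num * dotC w z)).
  rewrite [_ * N]mulrC -!mulrA -!expRD; congr (_ * expR _).
  by rewrite /dotC !sqr_normc !ReB !ImB; field.
rewrite expRN ler_pdivrMr ?expR_gt0// => /le_trans; apply.
by rewrite /schur_exp expRD; lra.
Qed.

End Kernel.

End FockOperator.

(** * The integral operator extending [S] *)

Section FockExtension.
Context {R : realType}.
Local Notation plane := (measurableTypeR R * measurableTypeR R)%type.
Implicit Types (f g : R[i] -> R[i]) (z w : R[i]).
Variable alpha : {posnum R}.

Lemma cderiv_at_quadratic f z d (K : R) : 0 <= K ->
  (forall t, normc t <= 1 -> normc (f (z + t) - f z - d * t) <= K * normc t ^+ 2) ->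
  cderiv_at f z d.
Proof.
move=> K0 H e e0; exists (Num.min 1 (e / (K + 1))).
  by rewrite lt_min ltr01 divr_gt0// ltr_pwDr.
move=> t; rewrite lt_min => /andP[t1 te].
apply: (le_trans (H t (ltW t1))); rewrite expr2 mulrA ler_wpM2r ?normc_ge0//.
move: te; rewrite ltr_pdivlMr ?ltr_pwDr// => te.
by apply/ltW/(le_lt_trans _ te); rewrite mulrC ler_wpM2l ?normc_ge0// lerDl.
Qed.

(** The product [|f| e^(b |x|^2)] is at most [|f|^2 + e^(2 b |x|^2)], which is integrable. The
    constant depends only on [f] and [b] and the bound is linear in [A], so a remainder of order
    [|t|^2] in [B] stays of that order after integration. *)
Lemma fock_gaussian_cintegral (b : R) f : fock alpha f -> 2 * b < alpha%:num ->
  exists2 K, 0 <= K & forall (B : plane -> R[i]) (A : R), cmeasurable B ->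
    (forall x, normc (B x) <= A * expR (b * normc (toC x) ^+ 2)) ->
    cintegrable (fock_measure alpha) (fun x => f (toC x) * B x) /\
    normc (cintegral (fock_measure alpha) (fun x => f (toC x) * B x)) <= A * K.
Proof.
move=> /fockP[ef of_] ba.
have mf := entire_measurable ef; have mnf := cmeasurable_normc mf.
pose G (x : plane) := normc (f (toC x)) * expR (b * normc (toC x) ^+ 2).
have mG : measurable_fun [set: plane] G.
  by apply: measurable_funM => //; exact: measurable_gaussian.
have G0 x : 0 <= G x by rewrite mulr_ge0 ?normc_ge0 ?expR_ge0.
pose J := (\int[fock_measure alpha]_x (G x)%:E)%E.
have J0 : (0 <= J)%E by apply: integral_ge0 => x _; rewrite lee_fin.
have Joo : (J < +oo)%E.
  apply: (@le_lt_trans _ _ (sqnorm alpha f +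
     \int[fock_measure alpha]_x (expR (2 * b * normc (toC x) ^+ 2))%:E)%E).
    rewrite /sqnorm -ge0_integralD//; last 3 first.
    - by move=> x _; rewrite lee_fin sqr_ge0.
    - by apply/measurable_EFinP; exact: measurable_sqnormc.
    - by apply/measurable_EFinP; exact: measurable_gaussian.
    apply: ge0_le_integral => //=.
    - by move=> x _; rewrite lee_fin.
    - exact/measurable_EFinP.
    - apply/measurable_EFinP; apply: measurable_funD.
        exact: measurable_sqnormc.
      exact: measurable_gaussian.
    - move=> x _; rewrite lee_fin /G -mulrA expRM_natl.
      have := normc_ge0 (f (toC x)); have := expR_ge0 (b * normc (toC x) ^+ 2).
      by move: (normc (f _)) (expR _) => u v; nra.
  by rewrite lte_add_pinfty// fock_gaussian// ltry.
have Jfin : J \is a fin_num by rewrite ge0_fin_numE.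
exists (2 * fine J); first by rewrite mulr_ge0// fine_ge0.
move=> B A mB BA.
have A0 : 0 <= A.
  have := le_trans (normc_ge0 _) (BA (0, 0)).
  by rewrite pmulr_lge0// expR_gt0.
have mfB : cmeasurable (fun x => f (toC x) * B x) by exact: cmeasurableM.
have le x : normc (f (toC x) * B x) <= A * G x.
  by rewrite normcM /G mulrCA; apply: ler_wpM2l => //; exact: normc_ge0.
have AGE : (\int[fock_measure alpha]_x (A * G x)%:E = A%:E * J)%E.
  under eq_integral do rewrite EFinM.
  rewrite ge0_integralZl//; first exact/measurable_EFinP.
  by move=> x _; rewrite lee_fin.
have mAG : measurable_fun [set: plane] (fun x => A * G x) by exact: measurable_funM.
have iF : cintegrable (fock_measure alpha) (fun x => f (toC x) * B x).
  apply: (cintegrable_dominated mfB mAG le).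
  by rewrite AGE lte_mul_pinfty.
split=> //; rewrite -lee_fin; apply: (le_trans (normc_cintegral iF)).
rewrite mulrCA !EFinM (fineK Jfin) -AGE lee_wpmul2l//.
apply: ge0_le_integral => //=.
- by move=> x _; rewrite lee_fin normc_ge0.
- by apply/measurable_EFinP; exact: cmeasurable_normc.
- exact/measurable_EFinP.
- by move=> x _; rewrite lee_fin.
Qed.

Variables (S : fock_operator alpha) (hS : standing_assumptions S).
Variables (p C : R).
Hypothesis p2 : 2 < p.
Hypothesis Sp : forall z, (fock_norm alpha p (fock_conj S z (fun=> 1%R)) <= C%:E)%E.

Let a := alpha%:num / p.
Let b := a / 2 + alpha%:num / 4.

Let p0 : 0 < p.
Proof. by apply: lt_trans p2; rewrite ltr0n. Qed.

Let a_lt : a < alpha%:num / 2.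
Proof. by rewrite /a ltr_pM2l// ltf_pV2 ?posrE. Qed.

Let b_lt : 2 * b < alpha%:num.
Proof. by have := a_lt; rewrite /b; lra. Qed.

Let C0 : 0 <= C.
Proof.
by rewrite -lee_fin; apply: le_trans (Sp 0); exact: Lnorm_ge0.
Qed.

Let kernel_bound := op_kernel_bound hS p2 Sp.

(** Separates the variables. The exponent [b], midway between [a] and [alpha / 2], stays below
    [alpha / 2], as integration over [w] against a Fock function requires; the growth in [u] is
    unconstrained, since [entire_taylor_bound] accepts any Gaussian rate. *)
Let kernel_growth w u : normc (S (fock_kernel alpha w) u) <=
  2 * C * expR (b * normc w ^+ 2) * expR ((alpha%:num - a) * normc u ^+ 2).
Proof.
apply: (le_trans (kernel_bound w u)); rewrite -[leRHS]mulrA -expRD.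
apply: ler_wpM2l; first by rewrite mulr_ge0.
rewrite ler_expR /schur_exp -/a.
(* Weight 2 turns the cross term [(alpha - 2 a) w.u] into exactly what completes the coefficients to
   [b] and [alpha - a]. *)
have := dotC_le w u (ltr0n R 2); have := a_lt.
have -> : normc (w - u) ^+ 2 = normc w ^+ 2 + normc u ^+ 2 - 2 * dotC w u.
  by rewrite !sqr_normc ReB ImB /dotC; ring.
rewrite /b; move: (normc w ^+ 2) (normc u ^+ 2) (dotC w u) (a) => x y d a' ha hd.
have : (alpha%:num - 2 * a') * (2 * d) <= (alpha%:num - 2 * a') * (2^-1 * x + 2 * y).
  by apply: ler_wpM2l => //; lra.
lra.
Qed.

(** [h] is [S^* K_z]. Its membership in [fock] yields both measurability and integrability of the
    kernel in the variable [w]. *)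
Lemma op_adjoint z : exists2 h, fock alpha h &
  (forall f, dom S f -> S f z = fock_inner alpha f h) /\
  (forall w, h w = conjc (S (fock_kernel alpha w) z)).
Proof.
have [_ [h fh hE]] := kernel_adjoint_dom hS z.
have SE f : dom S f -> S f z = fock_inner alpha f h.
  by move=> df; rewrite -hE// fock_reproducing//; exact: op_fock.
exists h => //; split=> // w; rewrite -(fock_reproducing w fh).
rewrite fock_inner_conj//; last exact: fock_fock_kernel.
by rewrite -SE//; exact: kernel_dom.
Qed.

(** [S f z = <f, S^* K_z>], where [S^* K_z w] is the conjugate of [S K_w z]. *)
Definition kernel_op f z : R[i] := cintegral (fock_measure alpha)
  (fun x => f (toC x) * S (fock_kernel alpha (toC x)) z).

Lemma kernel_op_inner f z h : (forall w, h w = conjc (S (fock_kernel alpha w) z)) ->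
  kernel_op f z = fock_inner alpha f h.
Proof.
by move=> hE; congr cintegral; apply/funext => x; rewrite hE conjcK.
Qed.

Lemma kernel_opE f : dom S f -> kernel_op f = S f.
Proof.
move=> df; apply/funext => z; have [h fh [SE hE]] := op_adjoint z.
by rewrite (kernel_op_inner f hE) SE.
Qed.

Lemma cmeasurable_kernel z :
  cmeasurable (fun x : plane => S (fock_kernel alpha (toC x)) z).
Proof.
have [h [eh _] [_ hE]] := op_adjoint z.
rewrite (_ : (fun x => _) = fun x : plane => conjc (h (toC x))).
  by apply: cmeasurable_conj; exact: entire_measurable.
by apply/funext => x; rewrite hE conjcK.
Qed.

Lemma kernel_op_cintegrable f z : fock alpha f -> cintegrable (fock_measure alpha)
  (fun x => f (toC x) * S (fock_kernel alpha (toC x)) z).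
Proof.
move=> ff; have [h fh [_ hE]] := op_adjoint z.
rewrite (_ : (fun x => _) = fun x => f (toC x) * conjc (h (toC x))).
  exact: fock_cintegrable ff fh.
by apply/funext => x; rewrite hE conjcK.
Qed.

(** Differentiation under the integral sign: the Taylor remainder of [S K_w] at [z] is at most
    [K (2 C) e^(b |w|^2) |t|^2] with [K] independent of [w], and this can be integrated against
    [f]. *)
Lemma entire_kernel_op f : fock alpha f -> entire (kernel_op f).
Proof.
move=> ff; apply/entire_cderiv => z.
have ca : 0 <= alpha%:num - a.
  by have := a_lt; have : 0 < alpha%:num by []; lra.
have [K K0 HK] := entire_taylor_bound z ca.
have eS w : entire (S (fock_kernel alpha w)).
  by have [] := op_fock (kernel_dom hS w).
have /choice[d Hd] w := HK _ _ (eS w) (kernel_growth w).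
have [L L0 HL] := fock_gaussian_cintegral ff b_lt.
have M0 : 0 <= 2 * C by rewrite mulr_ge0.
(* The derivatives [d w] come from a choice, so measurability is recovered from difference quotients
   with step [1 / (n + 1)]. *)
have md : cmeasurable (fun x : plane => d (toC x)).
  apply: (@cmeasurable_cvg _ _ _ (fun n x => n.+1%:R *
     (S (fock_kernel alpha (toC x)) (z + n.+1%:R^-1) +
      (-1) * S (fock_kernel alpha (toC x)) z))).
    move=> n; apply: cmeasurableM; first exact: cmeasurable_cst.
    apply: cmeasurableD; first exact: cmeasurable_kernel.
    by apply: cmeasurableM; [exact: cmeasurable_cst|exact: cmeasurable_kernel].
  move=> x e e0; pose M := K * (2 * C * expR (b * normc (toC x) ^+ 2)).
  have M'0 : 0 <= M by rewrite !mulr_ge0// expR_ge0.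
  (* The quadratic remainder, multiplied by [n + 1], leaves an error of [M / (n + 1)]. *)
  exists (Num.trunc (M / e)) => n Mn.
  have n0 : 0 < n.+1%:R :> R by [].
  have tE : normc (n.+1%:R^-1 : R[i]) = n.+1%:R^-1.
    have -> : (n.+1%:R : R[i]) = (n.+1%:R : R)%:C by rewrite rmorph_nat.
    by rewrite normcV normc_real ger0_norm.
  have nE : normc (n.+1%:R : R[i]) = n.+1%:R.
    have -> : (n.+1%:R : R[i]) = (n.+1%:R : R)%:C by rewrite rmorph_nat.
    by rewrite normc_real ger0_norm.
  have := Hd (toC x) n.+1%:R^-1; rewrite tE.
  have -> : n.+1%:R^-1 <= 1 :> R by rewrite invf_le1// ler1n.
  move=> /(_ isT) h.
  have -> : n.+1%:R * (S (fock_kernel alpha (toC x)) (z + n.+1%:R^-1) +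
      (-1) * S (fock_kernel alpha (toC x)) z) - d (toC x) =
      n.+1%:R * (S (fock_kernel alpha (toC x)) (z + n.+1%:R^-1) -
       S (fock_kernel alpha (toC x)) z - d (toC x) * n.+1%:R^-1).
    rewrite [in RHS]mulrBr [n.+1%:R * (d _ * _)]mulrCA divff ?pnatr_eq0//.
    by rewrite mulr1 mulN1r.
  rewrite normcM nE.
  apply: (le_trans (ler_wpM2l (ltW n0) h)); rewrite -/M.
  rewrite expr2 mulrCA [_ * (_ / _)]mulrA divff ?gt_eqF// mul1r.
  rewrite ler_pdivrMr// mulrC -ler_pdivrMr//.
  by apply/ltW/(lt_le_trans (truncnS_gt _)); rewrite ler_nat.
(* The Taylor bound at [t = 1] controls the derivative by the values of [S K_w] at [z] and
   [z + 1]. *)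
have dN x : normc (d (toC x)) <= (2 * C * expR ((alpha%:num - a) * normc (z + 1) ^+ 2) +
    2 * C * expR ((alpha%:num - a) * normc z ^+ 2) + K * (2 * C)) *
    expR (b * normc (toC x) ^+ 2).
  have := Hd (toC x) 1; rewrite normc1 lexx mulr1 expr1n mulr1 => /(_ isT).
  have := kernel_growth (toC x) (z + 1); have := kernel_growth (toC x) z.
  set u := S _ (z + 1); set v := S _ z => hv hu huv.
  have := le_normcB (- d (toC x)) (v - u); rewrite normcN.
  have -> : - d (toC x) - (v - u) = u - v - d (toC x) by ring.
  have := le_normcD v (- u); rewrite normcN; lra.
have [iD _] := HL _ _ md dN.
exists (cintegral (fock_measure alpha) (fun x => f (toC x) * d (toC x))).
apply: (@cderiv_at_quadratic _ _ _ (K * (2 * C) * L)); first by rewrite !mulr_ge0.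
move=> t t1.
(* The Taylor remainder in [z] of the kernel, written as a sum to match the linearity lemmas. *)
pose B (x : plane) := S (fock_kernel alpha (toC x)) (z + t) +
  ((-1) * S (fock_kernel alpha (toC x)) z + (- t) * d (toC x)).
have mB : cmeasurable B.
  apply: cmeasurableD; first exact: cmeasurable_kernel.
  apply: cmeasurableD; apply: cmeasurableM => //; try exact: cmeasurable_cst.
  exact: cmeasurable_kernel.
have BN x : normc (B x) <= K * (2 * C) * normc t ^+ 2 * expR (b * normc (toC x) ^+ 2).
  have -> : B x = S (fock_kernel alpha (toC x)) (z + t) -
     S (fock_kernel alpha (toC x)) z - d (toC x) * t by rewrite /B; ring.
  by apply: (le_trans (Hd (toC x) t t1)); lra.
have [iB BL] := HL _ _ mB BN.
have -> : kernel_op f (z + t) - kernel_op f z -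
    cintegral (fock_measure alpha) (fun x => f (toC x) * d (toC x)) * t =
    cintegral (fock_measure alpha) (fun x => f (toC x) * B x).
  have i0 := kernel_op_cintegrable (z + t) ff.
  have i1 := cintegrableZ (-1) (kernel_op_cintegrable z ff).
  have i2 := cintegrableZ (- t) iD.
  transitivity (cintegral (fock_measure alpha) (fun x =>
    f (toC x) * S (fock_kernel alpha (toC x)) (z + t) +
    ((-1) * (f (toC x) * S (fock_kernel alpha (toC x)) z) +
    (- t) * (f (toC x) * d (toC x))))).
    rewrite (cintegralD i0 (cintegrableD i1 i2)) (cintegralD i1 i2).
    rewrite (cintegralZ _ (kernel_op_cintegrable z ff)) (cintegralZ _ iD).
    by rewrite /kernel_op; ring.
  by congr cintegral; apply/funext => x; rewrite /B; ring.
by apply: (le_trans BL); lra.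
Qed.

(** The first 2 is from [normc_cintegral], [2 * C] from [op_kernel_bound], and the quotient is the
    constant of [schur_test]. *)
Definition extension_norm := 2 * (2 * C) * (alpha%:num / (alpha%:num / 2 - a)).

Lemma kernel_op_bound f : fock alpha f ->
  (sqnorm alpha (kernel_op f) <= (extension_norm ^+ 2)%:E * sqnorm alpha f)%E.
Proof.
move=> ff; have [ef _] := ff.
have M0 : 0 <= 2 * (2 * C) by rewrite !mulr_ge0.
apply: (schur_bound a_lt ef (entire_kernel_op ff) M0) => z.
apply: (le_trans (normc_cintegral (kernel_op_cintegrable z ff))).
rewrite EFinM -muleA lee_wpmul2l//.
have mE : measurable_fun [set: plane] (fun x => normc (f (toC x)) *
    expR (schur_exp alpha a z (toC x))).
  apply: measurable_funM.
    by apply: cmeasurable_normc; exact: entire_measurable.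
  have := measurableT_comp (measurable_schur_weight alpha a 0 0) (pair1_measurable (ofC z)).
  by congr measurable_fun; apply/funext => x /=; rewrite ofCK !mul0r !addr0.
rewrite -ge0_integralZl ?lee_fin ?mulr_ge0//; last 2 first.
- exact/measurable_EFinP.
- by move=> x _; rewrite lee_fin mulr_ge0 ?normc_ge0 ?expR_ge0.
apply: ge0_le_integral => //=.
- by move=> x _; rewrite lee_fin normc_ge0.
- apply/measurable_EFinP; apply: cmeasurable_normc.
  exact: (kernel_op_cintegrable z ff).1.
- by apply: emeasurable_funM; [exact: measurable_cst|exact/measurable_EFinP].
move=> x _; rewrite -EFinM lee_fin normcM mulrCA.
by apply: ler_wpM2l; [exact: normc_ge0|rewrite schur_expC; exact: kernel_bound].
Qed.

Lemma fock_kernel_op f : fock alpha f -> fock alpha (kernel_op f).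
Proof.
move=> ff; apply/fockP; split; first exact: entire_kernel_op.
apply: (le_lt_trans (kernel_op_bound ff)); have /fockP[_ foo] := ff.
by apply: lte_mul_pinfty => //; rewrite lee_fin sqr_ge0.
Qed.

Lemma kernel_op_linear c f g : fock alpha f -> fock alpha g ->
  kernel_op (fun z => c * f z + g z) = fun z => c * kernel_op f z + kernel_op g z.
Proof.
move=> ff fg; apply/funext => z.
have i1 := kernel_op_cintegrable z ff; have i2 := kernel_op_cintegrable z fg.
rewrite /kernel_op -(cintegralZ c i1) -(cintegralD (cintegrableZ c i1) i2).
by congr cintegral; apply/funext => x; rewrite mulrDl mulrA.
Qed.

Definition kernel_operator : fock_operator alpha :=
  @FockOperator R alpha (fock alpha) kernel_op (fun f ff => ff) (fock0 alpha)
    (fun c f g => @fock_linear R alpha c f g) fock_kernel_op kernel_op_linear.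

Lemma fock_bounded_of_conj_bound : fock_bounded S.
Proof.
have e0 : 0 <= extension_norm.
  rewrite /extension_norm; apply: mulr_ge0; first by rewrite !mulr_ge0.
  by apply: divr_ge0 => //; rewrite subr_ge0 ltW.
exists kernel_operator; split=> //; first exact: kernel_opE.
exists extension_norm => // f ff.
have H := kernel_op_bound ff.
(* Both sides become squares of extended reals, and monotonicity of the power [1 / 2] gives the norm
   inequality. *)
rewrite -!fock_norm_sqr in H.
have N0 g : (0 <= fock_norm alpha 2 g)%E by exact: Lnorm_ge0.
have E2 : ((extension_norm ^+ 2)%:E = extension_norm%:E `^ 2)%E.
  by rewrite poweR_EFin powR_mulrn.
rewrite E2 -poweRM ?lee_fin// in H.
have half0 : 0 <= 2^-1 :> R by rewrite invr_ge0.
have := @gt0_ler_poweR R _ half0 _ _ _ _ H.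
rewrite -!poweRrM divff ?pnatr_eq0// !poweRe1 ?mule_ge0 ?lee_fin//; apply.
- by rewrite in_itv/= poweR_ge0 leey.
- by rewrite in_itv/= poweR_ge0 leey.
Qed.

End FockExtension.

Theorem theoremA (R : realType) (alpha : {posnum R})
    (S : fock_operator alpha) (hS : standing_assumptions S) :
  (exists p C : R, [/\ 2 < p, 0 < C &
     forall z : R[i],
       (fock_norm alpha p (fock_conj S z (fun=> 1%R)) <= C%:E)%E]) ->
  fock_bounded S.
Proof.
move=> [p [C [p2 _ Sp]]]; exact: (fock_bounded_of_conj_bound hS p2 Sp).
Qed.
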